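(* Let $w,w'\in A_n^\dagger$. Then $w$ and $w'$ are Knuth equivalent if and only if for all timed words $u,v\in A_n^\dagger$ one has $a_k(uwv)=a_k(uw'v)$ for all $k\ge1$.
   Context: Let $A_n=\{1,\dots,n\}$ with its usual order. A timed word of length $r\ge 0$ in $A_n$ is a right-continuous piecewise-constant function $w:[0,r)\to A_n$ with finitely many discontinuities; $l(w)=r$. $A_n^\dagger$ is the monoid of timed words under concatenation. A timed row is a weakly increasing timed word. Greene invariants: for a finite disjoint union $S\subset[0,r)$ of intervals $[a,b)$, the timed subword $w_S$ is the timed word of length $\mathrm{meas}(S)$ obtained by concatenating the restrictions of $w$ to the component intervals of $S$ in increasing order; subwords $w_{S_1},\dots,w_{S_k}$ are pairwise disjoint if the $S_i$ are pairwise disjoint. $a_k(w)$ is the supremum of $l(v_1)+\dots+l(v_k)$ over $k$-tuples of pairwise disjoint timed subwords of $w$ that are timed rows. Timed Knuth relations: for timed rows $x,y,z$ such that $xyz$ is a timed row, $(\kappa_1)$: $xzy\equiv zxy$ if $l(z)=l(y)$ and $\lim_{t\to l(y)^-}y(t)<z(0)$; $(\kappa_2)$: $yxz\equiv yzx$ if $l(x)=l(y)$ and $\lim_{t\to l(x)^-}x(t)<y(0)$. Knuth equivalence on $A_n^\dagger$ is the equivalence relation generated by $pv_1q\equiv pv_2q$ for all timed words $p,q$ and all pairs $v_1,v_2$ forming the two sides of a timed Knuth relation. *)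

(* Defs.v *)
From HB Require Import structures.
From mathcomp Require Import all_boot all_order all_algebra.
From mathcomp Require Import all_classical all_reals all_analysis.
From Stdlib Require Export Relation_Operators.
Set Implicit Arguments.
Unset Strict Implicit.
Unset Printing Implicit Defensive.
Import Order.TTheory GRing.Theory Num.Theory numFieldNormedType.Exports.
Local Open Scope classical_set_scope.
Local Open Scope ring_scope.

(* A function [0, wlen[ -> {1, ..., n} is extended by 0, which is not a letter,
   to the whole real line, so that two timed words are the same function iff
   they are equal as elements of tword R.  The conditions that single out the
   timed words in A_n are in timed_word. *)
Record tword (R : realType) := TWord { wlen : R; wval :> R -> nat }.

(* nat carries the discrete topology, so a function with finitely many
   discontinuities is constant between two consecutive ones.  The point 0 is
   left out of the discontinuities: as w is defined on [0, wlen w[, continuity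
   at 0 is right-continuity at 0. *)
Record timed_word (R : realType) (n : nat) (w : tword R) : Prop := TimedWord {
  wlen_ge0 : 0 <= wlen w;
  wval_in : forall t : R, 0 <= t < wlen w -> (1 <= w t <= n)%N;
  wval_out : forall t : R, ~~ (0 <= t < wlen w) -> w t = 0%N;
  wval_right_continuous :
    forall t : R, 0 <= t < wlen w -> w s @[s --> t^'+] --> w t;
  wval_finite_discontinuities :
    finite_set [set t | 0 < t < wlen w /\ ~ {for t, continuous w}]
}.

Definition tempty (R : realType) : tword R := TWord 0 (fun=> 0%N).

Definition tcat (R : realType) (w1 w2 : tword R) : tword R :=
  TWord (wlen w1 + wlen w2)
        (fun t => if t < wlen w1 then w1 t else w2 (t - wlen w1)).

Declare Scope tword_scope.
Delimit Scope tword_scope with TW.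
Bind Scope tword_scope with tword.
Notation "w1 * w2" := (tcat w1 w2) : tword_scope.

Definition weakly_increasing (R : realType) (w : tword R) : Prop :=
  forall s t, 0 <= s -> s <= t -> t < wlen w -> (w s <= w t)%N.

Definition timed_row (R : realType) (n : nat) (w : tword R) : Prop :=
  timed_word n w /\ weakly_increasing w.

Definition trestrict (R : realType) (w : tword R) (ab : R * R) : tword R :=
  TWord (ab.2 - ab.1)
        (fun t => if 0 <= t < ab.2 - ab.1 then w (ab.1 + t) else 0%N).

(* A list S = [:: (a_1, b_1); ...; (a_m, b_m)] with
   0 <= a_1 < b_1 <= a_2 < b_2 <= ... <= a_m < b_m <= r
   stands for the disjoint union of the intervals [a_i, b_i[ in [0, r[. *)
Definition interval_union (R : realType) (r : R) (S : seq (R * R)) : bool :=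
  all (fun ab : R * R => [&& 0 <= ab.1, ab.1 < ab.2 & ab.2 <= r]) S
  && pairwise (fun ab cd : R * R => ab.2 <= cd.1) S.

Definition support_of (R : realType) (S : seq (R * R)) : set R :=
  \bigcup_(ab in [set` S]) `[ab.1, ab.2[%classic.

(* Splitting an interval of S into two adjacent ones does not change the
   value, so tsubword w S depends only on w and on support_of S. *)
Definition tsubword (R : realType) (w : tword R) (S : seq (R * R)) : tword R :=
  foldr (fun ab v => trestrict w ab * v)%TW (tempty R) S.

(* A timed subword of a timed word in A_n is again a timed word in A_n, so it
   is a timed row as soon as it is weakly increasing.
   The set whose supremum is taken is nonempty (take all S i empty) and bounded
   by wlen w, so sup is a genuine supremum. *)
Definition greene (R : realType) (k : nat) (w : tword R) : R :=
  sup [set x : R | exists S : 'I_k -> seq (R * R),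
    [/\ forall i, interval_union (wlen w) (S i),
        trivIset [set: 'I_k] (fun i => support_of (S i)),
        forall i, weakly_increasing (tsubword w (S i)) &
        x = \sum_(i < k) wlen (tsubword w (S i))]].

Definition last_letter (R : realType) (w : tword R) : nat :=
  lim (w t @[t --> (wlen w)^'-]).

(* If l(z) = l(y) = 0 (resp. l(x) = l(y) = 0), where the inequality is
   meaningless on paper, both sides of the relation are the same word. *)
Inductive timed_knuth (R : realType) (n : nat) : tword R -> tword R -> Prop :=
| timed_knuth1 (x y z : tword R) :
    timed_row n x -> timed_row n y -> timed_row n z ->
    timed_row n (x * y * z)%TW ->
    wlen z = wlen y -> (last_letter y < z 0%R)%N ->
    timed_knuth n (x * z * y)%TW (z * x * y)%TW
| timed_knuth2 (x y z : tword R) :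
    timed_row n x -> timed_row n y -> timed_row n z ->
    timed_row n (x * y * z)%TW ->
    wlen x = wlen y -> (last_letter x < y 0%R)%N ->
    timed_knuth n (y * x * z)%TW (y * z * x)%TW.

Inductive knuth_step (R : realType) (n : nat) : tword R -> tword R -> Prop :=
| KnuthStep (p q v1 v2 : tword R) :
    timed_word n p -> timed_word n q -> timed_knuth n v1 v2 ->
    knuth_step n (p * v1 * q)%TW (p * v2 * q)%TW.

Definition knuth_equivalent (R : realType) (n : nat) :
    tword R -> tword R -> Prop :=
  clos_refl_sym_trans (tword R) (knuth_step n).

(* Main.v *)
(* A timed word is a finite list of blocks (letter, duration), and a_k of such a
   list is the largest total duration of a set of blocks that is a union of k
   weakly increasing chains.

   Knuth equivalent words have equal Greene invariants: the tail-swapping proof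
   of Greene's theorem works for weighted letters, once y and z of a relation
   are cut into pieces of equal durations and exchanged piece by piece.

   Conversely, row insertion shows that every word is Knuth equivalent to the
   reading word of a tableau T.  Let r_i(m) be the total duration of the letters
   <= m in row i of T.  For k <= m and M large, the word
     v = m^M (m-1)^M ... (m-k+1)^M
   forces each of the k chains to use one block of v, hence only letters <= m of
   T, and a_k(T v) = k M + r_1(m) + ... + r_k(m).  These numbers determine T. *)

(* The invariants are suprema over arbitrary families of intervals, so the finite picture has to be
   justified: a block is constant, hence may be given whole to any chain that meets it, and the
   Lebesgue measure of the union of the supports shows that nothing is lost. Lists may contain
   blocks of duration 0. A row can then list all letters 1, ..., n, and insertion becomes a
   computation with cumulative lengths; the price is that lists are compared up to an equivalence.
   The second Knuth relation is the first one for the reversed word and the reversed order, so the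
   exchange is proved for any transitive relation. That letters <= m of T yield at most r_1(m) + ...
   + r_k(m) is a duality argument: cut T at column L = r_k(m). A chain weighs at most L left of the
   cut, since it covers each column at most once, and right of the cut the letters <= m weigh r_1(m)
   + ... + r_k(m) - k L in all. M is at least the total duration of T, so leaving out one block of v
   costs no less than all of T can bring. The range k <= m is enough because r_i(m) = 0 for i >
   m. *)
Require Import Defs.
From mathcomp Require Import all_boot all_order all_algebra.
From mathcomp Require Import all_classical all_reals all_analysis.
From mathcomp Require Import ring lra zify.
Set Implicit Arguments.
Unset Strict Implicit.
Unset Printing Implicit Defensive.
Import Order.TTheory GRing.Theory Num.Theory numFieldNormedType.Exports.
Local Open Scope classical_set_scope.
Local Open Scope ring_scope.

(** * Words made of blocks *)

Section Words.
Variable R : realType.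
Implicit Types (l : seq (nat * R)) (u v w : tword R).

Definition tconst (c : nat) (t : R) : tword R :=
  TWord t (fun s => if 0 <= s < t then c else 0%N).

Definition blocks l : tword R :=
  foldr (fun e v => tconst e.1 e.2 * v)%TW (tempty R) l.

Definition letters l : seq nat := [seq e.1 | e <- l].

Definition weight l : R := \sum_(e <- l) e.2.

Definition nonneg l : bool := all (fun e => 0 <= e.2) l.

Definition block_word n l : bool :=
  nonneg l && all (fun c => 1 <= c <= n)%N (letters l).

Lemma letters_cat l1 l2 : letters (l1 ++ l2) = letters l1 ++ letters l2.
Proof. exact: map_cat. Qed.

Lemma weight_cat l1 l2 : weight (l1 ++ l2) = weight l1 + weight l2.
Proof. exact: big_cat. Qed.

Lemma weight_cons e l : weight (e :: l) = e.2 + weight l.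
Proof. exact: big_cons. Qed.

Lemma weight_nil : weight [::] = 0.
Proof. exact: big_nil. Qed.

Lemma nonneg_cat l1 l2 : nonneg (l1 ++ l2) = nonneg l1 && nonneg l2.
Proof. exact: all_cat. Qed.

Lemma block_word_cat n l1 l2 :
  block_word n (l1 ++ l2) = block_word n l1 && block_word n l2.
Proof. by rewrite /block_word nonneg_cat letters_cat all_cat andbACA. Qed.

Lemma block_word_nonneg n l : block_word n l -> nonneg l.
Proof. by case/andP. Qed.

Lemma weight_ge0 l : nonneg l -> 0 <= weight l.
Proof.
elim: l => [|e l IH]; rewrite ?weight_nil ?weight_cons //= => /andP[he /IH].
exact: addr_ge0.
Qed.

Lemma tword_ext u v : wlen u = wlen v -> u =1 v -> u = v.
Proof. by case: u v => [lu fu] [lv fv] /= -> /funext ->. Qed.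

Lemma tcatA u v w : 0 <= wlen v -> (u * (v * w) = u * v * w)%TW.
Proof.
move=> hv; apply: tword_ext => /= [|t]; first by rewrite addrA.
rewrite ltrBlDl opprD addrA.
case: ltP => // h; first by rewrite ifT //; lra.
Qed.

Lemma tcat0w w : (forall t, t < 0 -> w t = 0%N) -> (tempty R * w = w)%TW.
Proof.
move=> h; apply: tword_ext => /= [|t]; first by rewrite add0r.
by rewrite subr0; case: ltP => // /h.
Qed.

Lemma tcatw0 w : (forall t, wlen w <= t -> w t = 0%N) -> (w * tempty R = w)%TW.
Proof.
move=> h; apply: tword_ext => /= [|t]; first by rewrite addr0.
by case: ltP => // /h.
Qed.

Lemma wlen_blocks l : wlen (blocks l) = weight l.
Proof. by elim: l => [|e l IH] /=; rewrite ?weight_nil ?weight_cons ?IH. Qed.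

Lemma blocks_out l t : nonneg l -> ~~ (0 <= t < weight l) -> blocks l t = 0%N.
Proof.
elim: l t => [|e l IH] t //= /andP[he hl] ht.
have hw := weight_ge0 hl; move: ht; rewrite weight_cons => ht.
case: ltP => h1; last by apply: IH => //; move: ht; apply: contra; lra.
by rewrite ifF //; apply: contraNF ht; lra.
Qed.

Lemma blocks_cat l1 l2 : nonneg l1 -> nonneg l2 ->
  blocks (l1 ++ l2) = (blocks l1 * blocks l2)%TW.
Proof.
elim: l1 => [|e l IH] /=.
  move=> _ h2; rewrite tcat0w // => t t0; apply: blocks_out => //.
  by rewrite negb_and -ltNge t0.
move=> /andP[he hl] h2; rewrite IH // tcatA // wlen_blocks.
exact: weight_ge0.
Qed.

Lemma blocks1 c t : blocks [:: (c, t)] = tconst c t.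
Proof.
by rewrite /= tcatw0 //= => s hs; rewrite ifF //; apply/negP; lra.
Qed.

Lemma right_cvgP (f : R -> nat) (t : R) :
  f s @[s --> t^'+] --> f t <->
  exists2 e, 0 < e & forall s, t < s < t + e -> f s = f t.
Proof.
split=> [h|[e e0 h]].
  have : nbhs (f t) [set f t] by exact: discrete_set1.
  move/h => /= [e /= e0 he]; exists e => // s hs.
  apply: (he s) => /=; last by case/andP: hs.
  by rewrite ltr_distl; lra.
move=> A /= /nbhs_singleton Aft.
exists e => //= s /=; rewrite ltr_distl => hs ts.
by rewrite (h s) //; lra.
Qed.

Lemma for_continuousP (f : R -> nat) (t : R) :
  {for t, continuous f} <->
  exists2 e, 0 < e & forall s, `|s - t| < e -> f s = f t.
Proof.
split=> [h|[e e0 h]].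
  have : nbhs (f t) [set f t] by exact: discrete_set1.
  move/h => /= [e /= e0 he]; exists e => // s hs.
  by apply: (he s) => /=; rewrite distrC.
move=> A /= /nbhs_singleton Aft.
by exists e => //= s /=; rewrite distrC => hs; rewrite /= (h s).
Qed.

Lemma lim_left (f : R -> nat) (t e : R) (c : nat) : 0 < e ->
  (forall s, t - e < s < t -> f s = c) -> lim (f s @[s --> t^'-]) = c.
Proof.
move=> e0 h; apply: cvg_lim; first exact: discrete_hausdorff.
move=> A /= /nbhs_singleton Ac.
exists e => //= s /=; rewrite ltr_distl => hs ts.
by rewrite (h s) //; lra.
Qed.

Lemma timed_word_tconst n c t : (1 <= c <= n)%N -> 0 <= t ->
  timed_word n (tconst c t).
Proof.
move=> hc ht; split=> // [s hs|s hs|s hs|].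
- by rewrite /= hs.
- by rewrite /= (negPf hs).
- apply/right_cvgP; move: hs => /= hs; exists (t - s); first lra.
  by move=> r hr /=; rewrite !ifT //; lra.
- suff -> : [set s | 0 < s < t /\ ~ {for s, continuous (tconst c t)}] = set0.
    exact: finite_set0.
  apply/seteqP; split=> // s /= [hs []]; apply/for_continuousP.
  exists (Num.min s (t - s)); first by rewrite lt_min; lra.
  move=> r /=; rewrite lt_min => hr.
  have {}hr : 0 <= r < t by move: hr; rewrite !ltr_distl; lra.
  by rewrite hr ifT //; lra.
Qed.

Lemma timed_word_tempty n : timed_word n (tempty R).
Proof.
split=> //= [t|t|]; try lra.
suff -> : [set s | 0 < s < 0 /\ ~ {for s, continuous (tempty R)}] = set0 :> set R.
  exact: finite_set0.
by apply/seteqP; split=> // s /= [hs]; lra.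
Qed.

Lemma timed_word_tcat n u v :
  timed_word n u -> timed_word n v -> timed_word n (u * v)%TW.
Proof.
move=> [u0 ui uo ur uf] [v0 vi vo vr vf]; split=> /=.
- exact: addr_ge0.
- by move=> t ht; case: ltP => h; [apply: ui|apply: vi]; lra.
- move=> t ht; case: ltP => h; [apply: uo|apply: vo]; apply: contra ht; lra.
- move=> t ht; apply/(@right_cvgP (u * v)%TW) => /=; case: ltP => h.
    have /right_cvgP[e e0 he] : u s @[s --> t^'+] --> u t by apply: ur; lra.
    exists (Num.min e (wlen u - t)); first by rewrite lt_min; lra.
    move=> s /=; rewrite -ltrBlDl lt_min => hs; rewrite ifT; last by lra.
    by apply: he; lra.
  have /right_cvgP[e e0 he] :
    v s @[s --> (t - wlen u)^'+] --> v (t - wlen u) by apply: vr; lra.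
  exists e => // s hs; rewrite ifF; last by apply/negP; lra.
  by apply: he; lra.
- apply: (@sub_finite_set _ _ ([set t | 0 < t < wlen u /\ ~ {for t, continuous u}]
    `|` ([set wlen u] `|` (fun t => wlen u + t) @`
      [set t | 0 < t < wlen v /\ ~ {for t, continuous v}]))); last first.
    by rewrite !finite_setU; split=> //; split; [exact: finite_set1|exact: finite_image].
  move=> t /= [ht hc]; case: (ltgtP t (wlen u)) => h; last by right; left.
    left; split; first lra.
    move=> /for_continuousP[e e0 he]; apply: hc; apply/for_continuousP.
    exists (Num.min e (wlen u - t)); first by rewrite lt_min; lra.
    move=> s; rewrite lt_min => /andP[h1 h2] /=; move: h2; rewrite ltr_distl => h2.
    by rewrite !ifT ?he //; lra.
  right; right; exists (t - wlen u); last by rewrite addrC subrK.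
  split; first lra.
  move=> /for_continuousP[e e0 he]; apply: hc; apply/for_continuousP.
  exists (Num.min e (t - wlen u)); first by rewrite lt_min; lra.
  move=> s; rewrite lt_min => /andP[h1 h2] /=; move: h2; rewrite ltr_distl => h2.
  rewrite !ifF; try by apply/negP; lra.
  by apply: he; rewrite opprB addrA subrK.
Qed.

Lemma timed_word_blocks n l : block_word n l -> timed_word n (blocks l).
Proof.
elim: l => [|[c t] l IH] /=; first by move=> _; exact: timed_word_tempty.
case/andP=> /= /andP[ht hl] /andP[hc hn].
apply: timed_word_tcat; first exact: timed_word_tconst.
by apply: IH; rewrite /block_word hl.
Qed.

End Words.

(** * Knuth equivalence of block words *)

Section Plactic.
Variables (R : realType) (n : nat).
Implicit Types (l p q x y z : seq (nat * R)) (a b c : nat) (s t : R).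

(** The first two moves do not change the timed word that a list denotes; the last two are the Knuth
    relations in which the two exchanged rows are single blocks of duration [t]. The general
    relations follow by matching pieces of equal duration. *)
Inductive block_step : seq (nat * R) -> seq (nat * R) -> Prop :=
| block_zero c : (1 <= c <= n)%N -> block_step [:: (c, 0)] [::]
| block_merge c s t : 0 <= s -> 0 <= t ->
    block_step [:: (c, s); (c, t)] [:: (c, s + t)]
| block_knuth1 x b c t : pairwise leq (letters x ++ [:: b]) -> (b < c)%N ->
    block_step (x ++ [:: (c, t); (b, t)]) ([:: (c, t)] ++ x ++ [:: (b, t)])
| block_knuth2 z a b t : pairwise leq (b :: letters z) -> (a < b)%N ->
    block_step ([:: (b, t); (a, t)] ++ z) ([:: (b, t)] ++ z ++ [:: (a, t)]).

Inductive block_equiv : seq (nat * R) -> seq (nat * R) -> Prop :=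
| block_equiv_step p q l l' : block_step l l' ->
    block_equiv (p ++ l ++ q) (p ++ l' ++ q)
| block_equiv_refl l : block_equiv l l
| block_equiv_sym l l' : block_equiv l l' -> block_equiv l' l
| block_equiv_trans l' l l'' :
    block_equiv l l' -> block_equiv l' l'' -> block_equiv l l''.

Local Notation "l1 ~~~ l2" := (block_equiv l1 l2) (at level 70).
Hint Resolve block_equiv_refl : core.

Lemma block_equiv_ctx p q l l' : l ~~~ l' -> (p ++ l ++ q) ~~~ (p ++ l' ++ q).
Proof.
elim=> {l l'} [p' q' l l' h|l|l l' _|l' l l'' _ h1 _ h2] //.
- have := block_equiv_step (p ++ p') (q' ++ q) h.
  by rewrite -!catA.
- exact: block_equiv_sym.
- exact: block_equiv_trans h1 h2.
Qed.

Lemma block_equiv1 l l' : block_step l l' -> l ~~~ l'.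
Proof. by move/(block_equiv_step [::] [::]); rewrite /= !cats0. Qed.

Lemma block_equiv_cat l1 l1' l2 l2' :
  l1 ~~~ l1' -> l2 ~~~ l2' -> (l1 ++ l2) ~~~ (l1' ++ l2').
Proof.
move=> /(block_equiv_ctx [::] l2) h1 /(block_equiv_ctx l1' [::]).
by rewrite !cats0; apply: block_equiv_trans.
Qed.

Lemma block_step_word l l' : block_step l l' -> block_word n l = block_word n l'.
Proof.
case=> [c hc|c s t hs ht|x b c t _ _|z a b t _ _] /=.
- by rewrite /block_word /= lexx hc.
- by rewrite /block_word /= hs ht addr_ge0 //= !andbT andbb.
- have e (c' d' : nat * R) : block_word n [:: c'; d'] = block_word n [:: c'] && block_word n [:: d'].
    exact: (block_word_cat n [:: c'] [:: d']).
  rewrite (block_word_cat n [:: _]) !block_word_cat e; exact: andbCA.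
- have e (c' d' : nat * R) : block_word n [:: c'; d'] = block_word n [:: c'] && block_word n [:: d'].
    exact: (block_word_cat n [:: c'] [:: d']).
  rewrite (block_word_cat n [:: _; _]) (block_word_cat n [:: _] (z ++ _)).
  by rewrite block_word_cat e -andbA; congr (_ && _); exact: andbC.
Qed.

Lemma block_equiv_word l l' : l ~~~ l' -> block_word n l = block_word n l'.
Proof.
elim=> {l l'} [p q l l' /block_step_word h|l|l l' _|l' l l'' _ -> _ ->] //.
by rewrite !block_word_cat h.
Qed.

(* Two block words with the same sequence of durations: (a, b, t) pairs a block
   of letter a with a block of letter b. *)
Implicit Types m : seq (nat * nat * R).
Definition lower m := [seq (e.1.1, e.2) | e <- m].
Definition upper m := [seq (e.1.2, e.2) | e <- m].

(** For the first pair (b, c), the second relation read backwards brings b next to c across the rest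
    of [upper m], the first relation carries c to the left of [x], and the induction goes on with b
    appended to [x]. Long rows thus need both single-block relations. *)
Lemma block_knuth1_matched m x :
  pairwise leq (letters x ++ letters (lower m)) ->
  pairwise leq (letters (upper m)) ->
  allrel ltn (letters (lower m)) (letters (upper m)) ->
  (x ++ upper m ++ lower m) ~~~ (upper m ++ x ++ lower m).
Proof.
elim: m x => [|[[b c] t] m IH] x //=; rewrite /= -/(upper m) -/(lower m).
rewrite pairwise_cat /= allrel_consr => /and3P[/andP[hxb hxm] hx /andP[hbm hm]].
move=> /andP[hc hu]; rewrite allrel_consl allrel_consr /=.
move=> /and3P[/andP[hbc _] _ hlu].
apply: (@block_equiv_trans (x ++ ([:: (c, t); (b, t)] ++ upper m) ++ lower m)).
  have := block_equiv_ctx x (lower m)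
    (block_equiv_sym (block_equiv1 (@block_knuth2 (upper m) b c t _ hbc))).
  by rewrite -!catA /=; apply; rewrite /= hc.
apply: (@block_equiv_trans
    (([:: (c, t)] ++ x ++ [:: (b, t)]) ++ upper m ++ lower m)).
  have := block_equiv_ctx [::] (upper m ++ lower m)
    (block_equiv1 (@block_knuth1 x b c t _ hbc)).
  rewrite /= -!catA /=; apply.
  by rewrite pairwise_cat allrel_consr allrel0r hxb hx.
have := block_equiv_ctx [:: (c, t)] [::] (IH (x ++ [:: (b, t)]) _ hu hlu).
rewrite !cats0 /= -!catA /=; apply.
by rewrite letters_cat !pairwise_cat allrel_catl allrel_consl allrel_consr
  allrel0r allrel0l hxm hbm hxb hx hm.
Qed.

(** Here the second relation alone suffices: a is brought next to b, the induction moves the other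
    pieces, and a then jumps over the rest of [upper m] together with [z]. *)
Lemma block_knuth2_matched m z :
  pairwise leq (letters (lower m)) ->
  pairwise leq (letters (upper m) ++ letters z) ->
  allrel ltn (letters (lower m)) (letters (upper m)) ->
  (upper m ++ lower m ++ z) ~~~ (upper m ++ z ++ lower m).
Proof.
elim: m z => [|[[a b] t] m IH] z //=; first by rewrite cats0.
rewrite /= -/(upper m) -/(lower m).
move=> /andP[ham hm]; rewrite all_cat => /andP[/andP[hbm hbz] hmz].
rewrite allrel_consl allrel_consr /= => /and3P[/andP[hab _] _ hlu].
apply: (@block_equiv_trans (([:: (b, t); (a, t)] ++ upper m) ++ lower m ++ z)).
  have := block_equiv_ctx [::] (lower m ++ z)
    (block_equiv_sym (block_equiv1 (@block_knuth2 (upper m) a b t _ hab))).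
  rewrite /= -!catA /=; apply; rewrite /= hbm.
  by move: hmz; rewrite pairwise_cat => /and3P[].
apply: (@block_equiv_trans
    ([:: (b, t); (a, t)] ++ (upper m ++ z ++ lower m))).
  have := block_equiv_ctx [:: (b, t); (a, t)] [::] (IH z hm hmz hlu).
  by rewrite !cats0.
have := block_equiv_ctx [::] (lower m)
    (block_equiv1 (@block_knuth2 (upper m ++ z) a b t _ hab)).
rewrite /= -!catA /=; apply.
by rewrite letters_cat /= all_cat hbm hbz.
Qed.

Implicit Types (f g : nat -> R).
Definition fblocks f (r : seq nat) : seq (nat * R) := [seq (c, f c) | c <- r].

Lemma letters_fblocks f r : letters (fblocks f r) = r.
Proof. by rewrite /letters -map_comp map_id. Qed.

Lemma eq_fblocks f g r : {in r, f =1 g} -> fblocks f r = fblocks g r.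
Proof. by move=> h; apply/eq_in_map => c hc; rewrite h. Qed.

Lemma fblocks_zero f r :
  {in r, forall c, (1 <= c <= n)%N} -> {in r, forall c, f c = 0} ->
  fblocks f r ~~~ [::].
Proof.
elim: r => [|c r IH] //= h1 h2; rewrite h2 ?mem_head //.
apply: (block_equiv_trans (l' := [:: (c, 0)])).
  apply: (@block_equiv_cat [:: (c, 0)] [:: (c, 0)] (fblocks f r) [::]) => //.
  by apply: IH => d hd; [apply: h1|apply: h2]; rewrite inE hd orbT.
by apply/block_equiv1/block_zero/h1/mem_head.
Qed.

Lemma fblocks_filter f r : {in r, forall c, (1 <= c <= n)%N} ->
  fblocks f [seq c <- r | f c != 0] ~~~ fblocks f r.
Proof.
elim: r => [|c r IH] //= hr.
have {}IH : fblocks f [seq c <- r | f c != 0] ~~~ fblocks f r.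
  by apply: IH => d hd; apply: hr; rewrite inE hd orbT.
have hc := hr c (mem_head _ _).
have [-> /=|_] := eqVneq (f c) 0; last exact: (@block_equiv_cat [:: (c, f c)] [:: (c, f c)] _ _ _ IH).
apply: (block_equiv_trans IH); apply: block_equiv_sym.
exact: (block_equiv_ctx [::] (fblocks f r) (block_equiv1 (block_zero hc))).
Qed.

(** The last hypothesis says that no letter present in [g] precedes a larger-indexed one present in
    [f]: the concatenation is already a row up to zero blocks, and only merging is left. *)
Lemma fblocks_add f g r :
  {in r, forall c, (1 <= c <= n)%N} ->
  {in r, forall c, 0 <= f c} -> {in r, forall c, 0 <= g c} ->
  pairwise (fun c d => (g c == 0) || (f d == 0)) r ->
  (fblocks f r ++ fblocks g r) ~~~ fblocks (fun c => f c + g c) r.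
Proof.
elim: r => [|c r IH] //= h1 hf hg /andP[/allP hc hr].
have h1c := h1 _ (mem_head _ _); have hfc := hf _ (mem_head _ _).
have hgc := hg _ (mem_head _ _).
have {}h1 d : d \in r -> (1 <= d <= n)%N by move=> hd; apply: h1; rewrite inE hd orbT.
have {}hf d : d \in r -> 0 <= f d by move=> hd; apply: hf; rewrite inE hd orbT.
have {}hg d : d \in r -> 0 <= g d by move=> hd; apply: hg; rewrite inE hd orbT.
have [gc0|gc0] := eqVneq (g c) 0.
  rewrite gc0 addr0.
  apply: (block_equiv_trans (l' := [:: (c, f c)] ++ (fblocks f r ++ fblocks g r))).
    have := block_equiv_ctx ((c, f c) :: fblocks f r) (fblocks g r)
      (block_equiv1 (block_zero h1c)).
    by [].
  by apply: (@block_equiv_cat [:: (c, f c)] [:: (c, f c)]) => //; apply: IH.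
have f0 d : d \in r -> f d = 0.
  by move=> hd; have := hc d hd; rewrite (negPf gc0) => /eqP.
apply: (block_equiv_trans (l' := [:: (c, f c); (c, g c)] ++ fblocks g r)).
  apply: (@block_equiv_ctx [:: (c, f c)] ((c, g c) :: fblocks g r) _ [::]).
  exact: fblocks_zero.
apply: (@block_equiv_cat _ [:: (c, f c + g c)] (fblocks g r)).
  exact/block_equiv1/block_merge.
rewrite (@eq_fblocks (fun d => f d + g d) g) // => d hd.
by rewrite f0 // add0r.
Qed.

Lemma merge_letter c (f : nat -> R) r : (1 <= c <= n)%N ->
  {in r, forall d, 0 <= f d} ->
  [seq (c, f d) | d <- r] ~~~ [:: (c, \sum_(d <- r) f d)].
Proof.
move=> hc; elim: r => [|d r IH] hf.
  by rewrite big_nil; apply/block_equiv_sym/block_equiv1/block_zero.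
rewrite big_cons /=.
have hr e : e \in r -> 0 <= f e by move=> he; apply: hf; rewrite inE he orbT.
apply: (block_equiv_trans (l' := [:: (c, f d); (c, \sum_(e <- r) f e)])).
  by apply: (@block_equiv_cat [:: (c, f d)] [:: (c, f d)] _ [:: _]) => //; apply: IH.
apply/block_equiv1/block_merge; first by apply: hf; rewrite mem_head.
by rewrite big_seq sumr_ge0.
Qed.

End Plactic.

(** * Row insertion and tableaux *)

Section Tableaux.
Variables (R : realType) (n : nat).
Implicit Types (r b : nat -> R) (c m : nat) (t : R) (T : seq (nat -> R)).

Local Notation "l1 ~~~ l2" := (block_equiv n l1 l2) (at level 70).
Hint Resolve block_equiv_refl : core.

(* A row is represented by its cumulative lengths: r m is the total duration
   of its letters <= m. *)
Definition is_row r := r 0%N = 0 /\ forall m, r m <= r m.+1.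

Definition mult r c : R := r c - r c.-1.

Definition row_blocks r : seq (nat * R) := fblocks (mult r) (iota 1 n).

Lemma row_mono r m k : is_row r -> (m <= k)%N -> r m <= r k.
Proof.
case=> _ h; elim: k => [|k IH]; first by rewrite leqn0 => /eqP ->.
rewrite leq_eqVlt => /predU1P[->//|/IH h1]; exact: le_trans h1 (h k).
Qed.

Lemma row_ge0 r m : is_row r -> 0 <= r m.
Proof. by move=> h; rewrite -(proj1 h); apply: row_mono. Qed.

Lemma mult_ge0 r c : is_row r -> 0 <= mult r c.
Proof. by move=> h; rewrite subr_ge0; apply: row_mono => //; exact: leq_pred. Qed.

Lemma eq_row_blocks r r' :
  (forall m, (m <= n)%N -> r m = r' m) -> row_blocks r = row_blocks r'.
Proof.
move=> h; apply: eq_fblocks => c; rewrite mem_iota => hc.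
by rewrite /mult !h //; lia.
Qed.

Lemma sum_mult r m k : (m <= k)%N -> \sum_(c <- iota m.+1 (k - m)) mult r c = r k - r m.
Proof.
move=> hmk; rewrite -{2}(subnKC hmk); elim: (k - m)%N => [|j IH].
  by rewrite big_nil addn0 subrr.
by rewrite -[j.+1]addn1 iotaD big_cat big_seq1 IH /mult !addn1 addnS addSn /=; ring.
Qed.

(** * Insertion of a single block into a row *)

Section InsertLetter.
Variables (r : nat -> R) (c : nat) (t : R).
Hypotheses (hr : is_row r) (hc : (1 <= c <= n)%N) (t0 : 0 <= t).

Definition insert_letter m : R :=
  if (m < c)%N then r m else Num.max (r c + t) (r m).

(** The bumped letters are the first ones above [c], up to a total duration [t]. When fewer are
    available the row grows, which is the role of [max] in [insert_letter]. *)
Definition bump_letter m : R :=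
  if (m < c)%N then 0 else Num.min (r m - r c) t.

Lemma bump_letter_row : is_row bump_letter.
Proof.
rewrite /bump_letter; split; first by case: ifP => //; case: c hc.
move=> m; have := row_mono hr (leqnSn m).
case: (ltngtP m.+1 c) => h; last first.
- by rewrite h subrr le_min lexx t0.
- by move=> ?; rewrite le_min !ge_min; lra.
- by [].
Qed.

(** Write the row as A P1 P2, with A the letters <= c, P1 the bumped part and P2 the rest, and c^t
    as c^u c^(t-u) with u the duration of P1. Then A P1 P2 c^u becomes A P1 c^u P2 by the second
    relation and P1 A c^u P2 by the first, and c^(t-u) passes P2 because one of the two is empty. *)
Lemma row_insert_letter :
  (row_blocks r ++ [:: (c, t)]) ~~~ (row_blocks bump_letter ++ row_blocks insert_letter).
Proof.
have [c1 cn] := andP hc.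
set lo := iota 1 c.-1; set hi := iota c.+1 (n - c).
have hiota : iota 1 n = lo ++ [:: c] ++ hi.
  rewrite /lo /hi -[in LHS](subnKC cn) iotaD -{1}(prednK c1) -[c.-1.+1]addn1 iotaD.
  by rewrite -catA /= add1n prednK.
have lo_c d : d \in lo -> (1 <= d < c)%N by rewrite mem_iota; lia.
have hi_c d : d \in hi -> (c < d <= n)%N by rewrite mem_iota; lia.
have letter d : d \in lo ++ [:: c] ++ hi -> (1 <= d <= n)%N.
  by rewrite -hiota mem_iota; lia.
pose p1 d := mult bump_letter d; pose p2 d := mult r d - p1 d.
have p1_ge0 d : 0 <= p1 d by exact: mult_ge0 bump_letter_row.
have p1E d : (c < d)%N -> p1 d = Num.min (r d - r c) t - Num.min (r d.-1 - r c) t.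
  move=> h; rewrite /p1 /mult /bump_letter.
  have -> : (d < c)%N = false by lia.
  by have -> : (d.-1 < c)%N = false by lia.
have p2_ge0 d : (c < d)%N -> 0 <= p2 d.
  move=> h; rewrite /p2 p1E // /mult.
  have := row_mono hr (leq_pred d); rewrite !minEle.
  by case: ifPn; case: ifPn; lra.
have p2E d : (c < d)%N -> p2 d = mult insert_letter d.
  move=> h; rewrite /p2 p1E // /mult /insert_letter.
  have -> : (d < c)%N = false by lia.
  have -> : (d.-1 < c)%N = false by lia.
  by rewrite !minEle !maxEle; do 4 case: ifPn; lra.
(* Bumped letters come before kept ones: if part of the letter [d] is kept, the duration [t] is
   exhausted there and no later letter is bumped. *)
have p12 d e : (c < d < e)%N -> p2 d = 0 \/ p1 e = 0.
  move=> /andP[h1 h2]; have h3 := ltn_trans h1 h2; rewrite /p2 !p1E // /mult.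
  have := row_mono hr (leq_pred d); have := row_mono hr (leq_pred e).
  have : r d <= r e.-1 by apply: row_mono => //; lia.
  by rewrite !minEle; do 4 case: ifPn; move=> *; first [by left; lra | by right; lra].
pose s := r n - r c; pose u := Num.min s t.
(* Both parts range over [hi]. Only without their zero blocks is the concatenation weakly
   increasing, as the Knuth relations require. *)
pose hi1 := [seq d <- hi | p1 d != 0]; pose hi2 := [seq d <- hi | p2 d != 0].
have hi1_c d : d \in hi1 -> (c < d <= n)%N by rewrite mem_filter => /andP[_ /hi_c].
have hi_n d : d \in hi -> (1 <= d <= n)%N.
  by move=> hd; apply: letter; rewrite !mem_cat hd !orbT.
have sum_p1 : \sum_(d <- hi1) p1 d = u.
  have -> : \sum_(d <- hi1) p1 d = \sum_(d <- hi) p1 d.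
    rewrite big_filter big_mkcond; apply: eq_bigr => d _.
    by case: eqVneq => // ->.
  rewrite sum_mult // /bump_letter ltnn subrr.
  have -> : (n < c)%N = false by lia.
  have -> : Num.min 0 t = 0 by rewrite minEle t0.
  by rewrite subr0.
have tu : 0 <= t - u by rewrite subr_ge0 ge_min lexx orbT.
pose A := fblocks (mult r) (lo ++ [:: c]).
pose m := [seq ((c, d), p1 d) | d <- hi1].
have upm : upper m = fblocks p1 hi1 by rewrite /upper -map_comp.
have lom : lower m = [seq (c, p1 d) | d <- hi1] by rewrite /lower -map_comp.
have sortiota i k : pairwise leq (iota i k).
  by rewrite -sorted_pairwise; [exact: iota_sorted|exact: leq_trans].
have lolom : letters (lower m) = map (fun=> c) hi1 by rewrite lom /letters -map_comp.
have lowc : forall e, e \in letters (lower m) -> e = c.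
  by move=> e; rewrite lolom => /mapP[? _ ->].
have split_c : (lower m ++ [:: (c, t - u)]) ~~~ [:: (c, t)].
  apply: (block_equiv_trans (l' := [:: (c, u); (c, t - u)])).
    apply: (@block_equiv_cat _ _ _ [:: (c, u)] [:: _] [:: _]) => //.
    by rewrite lom -sum_p1; apply: merge_letter.
  have {2}-> : t = u + (t - u) by rewrite addrC subrK.
  by apply/block_equiv1/block_merge => //; rewrite -sum_p1 big_seq sumr_ge0.
have pw_low : pairwise leq (letters (lower m)).
  by rewrite lolom; elim: (hi1) => //= d l ->; rewrite andbT all_map; apply/allP => e /=.
have lt_lu : allrel ltn (letters (lower m)) (letters (upper m)).
  apply/allrelP => d e /lowc ->; rewrite upm letters_fblocks => /hi1_c.
  by case/andP.
have f1 : fblocks p1 hi1 ~~~ fblocks p1 hi by exact: fblocks_filter.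
have f2 : fblocks p2 hi2 ~~~ fblocks p2 hi by exact: fblocks_filter.
have h1 : (row_blocks r ++ [:: (c, t)]) ~~~
    (A ++ (upper m ++ fblocks p2 hi2 ++ lower m) ++ [:: (c, t - u)]).
  have -> : row_blocks r = A ++ fblocks (mult r) hi.
    by rewrite /row_blocks hiota /A /fblocks !map_cat catA.
  rewrite -!catA; apply: block_equiv_cat => //.
  rewrite catA; apply: block_equiv_cat; last exact: block_equiv_sym.
  rewrite (@eq_fblocks _ _ (fun d => p1 d + p2 d)); last by move=> d _; rewrite addrC subrK.
  rewrite upm; apply/block_equiv_sym.
  apply: (block_equiv_trans (block_equiv_cat f1 f2)).
  apply: fblocks_add => //; first by move=> d /hi_c /andP[/p2_ge0].
  have := iota_ltn_sorted c.+1 (n - c); rewrite (sorted_pairwise ltn_trans).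
  apply: (@sub_in_pairwise _ (mem hi) ltn); last by apply/allP.
  move=> d e /hi_c hd /hi_c he /= hde.
  by have [|->|->] := p12 d e; rewrite ?eqxx ?orbT //; lia.
have h2 : (upper m ++ fblocks p2 hi2 ++ lower m) ~~~
    (upper m ++ lower m ++ fblocks p2 hi2).
  apply/block_equiv_sym/block_knuth2_matched => //.
  rewrite upm !letters_fblocks pairwise_cat !pairwise_filter ?sortiota // !andbT.
  apply/allrelP => d e; rewrite !mem_filter => /andP[hd1 /hi_c hd] /andP[he2 /hi_c he].
  rewrite leqNgt; apply/negP => hed.
  have /andP[hce _] := he.
  have [|h0|h0] := p12 e d; first by rewrite hce hed.
    by rewrite h0 eqxx in he2.
  by rewrite h0 eqxx in hd1.
have h3 : (A ++ upper m ++ lower m) ~~~ (upper m ++ A ++ lower m).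
  apply: block_knuth1_matched => //; last first.
    by rewrite upm letters_fblocks pairwise_filter // sortiota.
  have lepw (q : seq nat) : all (leq^~ c) q -> pairwise leq q ->
      pairwise leq (q ++ letters (lower m)).
    move=> hq pq; rewrite pairwise_cat pq pw_low !andbT.
    by apply/allrelP => d e hd /lowc ->; exact: (allP hq).
  rewrite /A letters_fblocks; apply: lepw.
    by apply/allP => d; rewrite mem_cat inE => /orP[/lo_c|/eqP ->]; lia.
  by have := sortiota 1%N n; rewrite hiota catA pairwise_cat => /and3P[].
(* Either every letter above [c] is bumped, or all of c^t is used up by the bumping. *)
have h4 : (fblocks p2 hi2 ++ [:: (c, t - u)]) ~~~ ([:: (c, t - u)] ++ fblocks p2 hi2).
  have [st|ts] := leP s t.
    have hz : fblocks p2 hi2 ~~~ [::].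
      apply: (block_equiv_trans f2).
      apply: fblocks_zero => // d /hi_c hd.
      have h : r d <= r n by apply: row_mono => //; lia.
      have h' := row_mono hr (leq_pred d).
      rewrite /p2 p1E; last by lia.
      by rewrite !minEle /mult; move: st; rewrite /s; do 2 case: ifPn; lra.
    apply: (block_equiv_trans (block_equiv_cat hz (block_equiv_refl _ _))).
    rewrite -[[::] ++ _]cats0.
    exact: block_equiv_cat (block_equiv_refl _ _) (block_equiv_sym hz).
  have -> : t - u = 0 by rewrite /u minEle leNgt ts subrr.
  have hz : [:: (c, 0 : R)] ~~~ [::] by exact/block_equiv1/block_zero.
  apply: (block_equiv_trans (block_equiv_cat (block_equiv_refl _ _) hz)).
  rewrite cats0 -[X in X ~~~ _]cat0s.
  exact: block_equiv_cat (block_equiv_sym hz) (block_equiv_refl _ _).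
apply: (block_equiv_trans h1).
apply: (block_equiv_trans (l' := (A ++ upper m ++ lower m) ++ fblocks p2 hi2 ++ [:: (c, t - u)])).
  rewrite -!catA; apply: block_equiv_cat => //.
  have := block_equiv_cat h2 (block_equiv_refl n [:: (c, t - u)]).
  by rewrite -!catA.
apply: (block_equiv_trans (block_equiv_cat h3 h4)).
rewrite -!catA.
have -> : row_blocks bump_letter = fblocks (mult bump_letter) (lo ++ [:: c]) ++ fblocks p1 hi.
  by rewrite /row_blocks hiota /fblocks !map_cat catA.
have -> : row_blocks insert_letter =
    fblocks (mult insert_letter) lo ++ [:: (c, mult r c + t)] ++ fblocks p2 hi.
  rewrite /row_blocks hiota /fblocks !map_cat /=; congr (_ ++ (_ , _) :: _).
    rewrite /mult /insert_letter ltnn prednK // leqnn maxEle.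
    have h0 := t0; case: ifPn => h; first lra.
    lra.
  by apply: eq_fblocks => d /hi_c /andP[/p2E].
(* The pieces of c^t are put together again, and are absorbed at the end by the block of [c] in
   [A]. *)
apply: (block_equiv_trans (l' := upper m ++ A ++ [:: (c, t)] ++ fblocks p2 hi)).
  apply: block_equiv_cat => //; apply: block_equiv_cat => //.
  by rewrite catA; apply: block_equiv_cat.
apply: (block_equiv_trans (l' := fblocks p1 hi ++ A ++ [:: (c, t)] ++ fblocks p2 hi)).
  by rewrite upm; apply: block_equiv_cat.
rewrite -catA -[X in X ~~~ _]cat0s; apply: block_equiv_cat.
  apply/block_equiv_sym/fblocks_zero => d.
    by move=> hd; apply: letter; rewrite catA mem_cat hd.
  rewrite mem_cat /mult /bump_letter => /orP[/lo_c|] hd.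
    have -> : (d < c)%N by lia.
    have -> : (d.-1 < c)%N by lia.
    exact: subrr.
  move: hd; rewrite inE => /eqP ->; rewrite ltnn prednK // leqnn subrr subr0.
  by rewrite minEle t0.
apply: block_equiv_cat => //.
have -> : A = fblocks (mult insert_letter) lo ++ [:: (c, mult r c)].
  rewrite /A /fblocks map_cat; congr (_ ++ _).
  apply: (@eq_fblocks _ (mult r)) => d /lo_c hd; rewrite /mult /insert_letter.
  have -> : (d < c)%N by lia.
  by have -> : (d.-1 < c)%N by lia.
rewrite -catA; apply: block_equiv_cat => //.
apply: (@block_equiv_cat _ _ ([:: (c, mult r c)] ++ [:: (c, t)]) [:: (c, mult r c + t)]) => //.
exact/block_equiv1/block_merge/t0/mult_ge0.
Qed.
End InsertLetter.
End Tableaux.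

(** * Insertion of a whole row into a tableau *)

Section RowInsertion.
Variables (R : realType) (n : nat).
Implicit Types (r b : nat -> R) (c m : nat) (t : R) (T : seq (nat -> R)).

Local Notation "l1 ~~~ l2" := (block_equiv n l1 l2) (at level 70).
Hint Resolve block_equiv_refl : core.

(* insert_row r b m is the length of the longest weakly increasing subword with
   letters <= m of the concatenation of r and b. *)
Fixpoint insert_row r b m : R :=
  if m is m'.+1 then Num.max (insert_row r b m') (r m'.+1) + (b m'.+1 - b m')
  else 0.

Definition bump_row r b m : R := r m + b m - insert_row r b m.

Lemma is_row_insert r b : is_row r -> is_row b -> is_row (insert_row r b).
Proof.
move=> hr [_ hb]; split=> // m /=; have := hb m.
by rewrite maxEle; case: ifPn; lra.
Qed.

Lemma insert_row_ge r b m : is_row r -> is_row b -> r m <= insert_row r b m.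
Proof.
case=> r0 hr [_ hb]; case: m => [|m] /=; first by rewrite r0.
by have := hb m; rewrite maxEle; case: ifPn; lra.
Qed.

Lemma is_row_bump r b : is_row r -> is_row b -> is_row (bump_row r b).
Proof.
move=> hr hb; have [r0 r1] := hr; have [b0 b1] := hb; rewrite /bump_row; split.
  by rewrite r0 b0 /=; ring.
move=> m /=; have := insert_row_ge m hr hb; have := r1 m; have := b1 m.
by rewrite maxEle; case: ifPn; lra.
Qed.

Lemma insert_row_blocks r b : is_row r -> is_row b ->
  (row_blocks n r ++ row_blocks n b) ~~~
  (row_blocks n (bump_row r b) ++ row_blocks n (insert_row r b)).
Proof.
move=> hr hb; have [r0 r1] := hr; have [b0 b1] := hb.
have hi := is_row_insert hr hb; have [i0 i1] := hi.
(* [st c] and [acc c] are the row and the bumped letters once the letters <= c of [b] have been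
   inserted. Beyond [c] the inserted part overwrites the beginning of [r], hence the maximum. *)
pose st c m := if (m <= c)%N then insert_row r b m else Num.max (insert_row r b c) (r m).
pose acc c m := r m + b (minn m c) - st c m.
have stS c m : (c <= m)%N -> st c m = Num.max (insert_row r b c) (r m).
  rewrite /st leq_eqVlt => /predU1P[->|h].
    by rewrite leqnn maxEle; have := insert_row_ge m hr hb; case: ifPn; lra.
  by rewrite leqNgt h.
have st_row c : is_row (st c).
  split; first by rewrite /st leq0n.
  move=> m; have [hmc|hcm] := leqP m.+1 c.
    by rewrite /st hmc ltnW.
  rewrite !stS //; last exact: ltnW.
  by rewrite !maxEle; have := r1 m; do 2 case: ifPn; lra.
suff h c : (c <= n)%N -> (row_blocks n r ++ fblocks (mult b) (iota 1 c)) ~~~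
    (row_blocks n (acc c) ++ row_blocks n (st c)).
  have -> : row_blocks n (bump_row r b) = row_blocks n (acc n).
    by apply: eq_row_blocks => m hm; rewrite /acc /st hm (minn_idPl hm).
  have -> : row_blocks n (insert_row r b) = row_blocks n (st n).
    by apply: eq_row_blocks => m hm; rewrite /st hm.
  exact: h.
elim: c => [_|c IH hc].
  rewrite cats0 -[X in X ~~~ _]cat0s; apply: block_equiv_cat.
    apply/block_equiv_sym/fblocks_zero => d; rewrite mem_iota; first lia.
    move=> hd; rewrite /mult /acc !minn0 b0 !stS // !maxEle /=.
    by rewrite !(row_ge0 _ hr); ring.
  rewrite (@eq_row_blocks _ _ r (st 0%N)) // => m _.
  by rewrite stS // maxEle /= (row_ge0 _ hr).
have hc1 : (1 <= c.+1 <= n)%N by [].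
have t0 : 0 <= mult b c.+1 by exact: mult_ge0.
have -> : fblocks (mult b) (iota 1 c.+1) =
    fblocks (mult b) (iota 1 c) ++ [:: (c.+1, mult b c.+1)].
  by rewrite -[in LHS](addn1 c) iotaD /fblocks map_cat add1n.
rewrite catA.
apply: (block_equiv_trans (block_equiv_cat (IH (ltnW hc)) (block_equiv_refl _ _))).
rewrite -catA.
apply: (block_equiv_trans (block_equiv_cat (block_equiv_refl _ _)
  (row_insert_letter (st_row c) hc1 t0))).
have insE : insert_letter (st c) c.+1 (mult b c.+1) =1 st c.+1.
  move=> m; rewrite /insert_letter; case: ltnP => h.
    have hm : (m <= c)%N by lia.
    by rewrite /st hm (leqW hm).
  rewrite !stS ?(ltnW h) // /mult /=.
  have hrm : r c.+1 <= r m by exact: row_mono.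
  have := b1 c; rewrite !maxEle; do ?[case: ifPn]; lra.
rewrite catA; apply: block_equiv_cat; last first.
  by rewrite (@eq_row_blocks _ _ _ (st c.+1)).
have accE m : acc c.+1 m = acc c m + bump_letter (st c) c.+1 (mult b c.+1) m.
  rewrite /acc -insE /insert_letter /bump_letter /mult; have [h|h] := ltnP m c.+1.
    have -> : minn m c = m by lia.
    ring.
  have -> : minn m c = c by lia.
  by rewrite minEle maxEle /=; case: ifPn; case: ifPn; lra.
have bl_row := bump_letter_row (st_row c) hc1 t0.
rewrite /row_blocks (@eq_fblocks _ (mult (acc c.+1))
  (fun d => mult (acc c) d + mult (bump_letter (st c) c.+1 (mult b c.+1)) d)); last first.
  by move=> d _; rewrite /mult !accE; ring.
have acc_row : is_row (acc c).
  split; first by rewrite /acc /st min0n /= r0 b0; ring.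
  move=> m; rewrite /acc; have [hmc|hcm] := ltnP m c.
    have := proj2 (is_row_bump hr hb) m.
    by rewrite /bump_row /st hmc (ltnW hmc) (minn_idPl hmc).
  rewrite !stS ?(leqW hcm) // (minn_idPr (leqW hcm)).
  by have := r1 m; rewrite !maxEle; do 2 case: ifPn; lra.
apply: fblocks_add.
- by move=> d; rewrite mem_iota; lia.
- by move=> d _; exact: mult_ge0.
- by move=> d _; exact: mult_ge0.
have := iota_ltn_sorted 1 n; rewrite (sorted_pairwise ltn_trans).
apply: sub_pairwise => d e hde.
have [hdc|hcd] := leqP d c.+1.
  rewrite {1}/mult /bump_letter.
  have -> : (d.-1 < c.+1)%N by lia.
  have [hd|] := ltnP d c.+1; first by rewrite subrr eqxx.
  move=> hd; have -> : d = c.+1 by lia.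
  by rewrite subrr subr0 minEle t0 eqxx.
have hd1 : r d.-1 <= r d by apply: row_mono => //; exact: leq_pred.
(* If the inserted part already reaches the end of the letters [d], none of them is left to bump;
   otherwise no letter [e] beyond [d] has been bumped so far. *)
have [hrd|hrd] := leP (r d) (insert_row r b c).
  have -> : mult (bump_letter (st c) c.+1 (mult b c.+1)) d = 0; last by rewrite eqxx.
  rewrite /mult /bump_letter.
  have -> : (d < c.+1)%N = false by lia.
  have -> : (d.-1 < c.+1)%N = false by lia.
  rewrite !stS; try lia.
  have -> : Num.max (insert_row r b c) (r d) = insert_row r b c by exact/max_idPl.
  have -> : Num.max (insert_row r b c) (r d.-1) = insert_row r b c.
    by apply/max_idPl/(le_trans hd1).
  exact: subrr.
have he : r d <= r e.-1 by apply: row_mono => //; lia.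
have he1 : r e.-1 <= r e by apply: row_mono => //; exact: leq_pred.
have -> : mult (acc c) e = 0; last by rewrite eqxx orbT.
rewrite /mult /acc !stS; try lia.
have -> : minn e c = c by lia.
have -> : minn e.-1 c = c by lia.
by rewrite !maxEle; do 2 case: ifPn; lra.
Qed.

(* Column strictness in terms of cumulative lengths. *)
Definition strictly_below r' r := forall m, r' m.+1 <= r m.

(* The stronger induction invariant [insert_row r' (bump_row r b) m <= r m]
   says that row r' cannot overtake the old first row. *)
Lemma strictly_below_insert r' r b : is_row r -> is_row b -> is_row r' ->
  strictly_below r' r ->
  strictly_below (insert_row r' (bump_row r b)) (insert_row r b).
Proof.
move=> hr hb hr' hd; have [r0 r1] := hr; have [b0 b1] := hb.
suff h m : insert_row r' (bump_row r b) m <= r m /\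
    insert_row r' (bump_row r b) m.+1 <= insert_row r b m.
  by move=> m; case: (h m).
have step k : insert_row r' (bump_row r b) k <= r k ->
    insert_row r' (bump_row r b) k.+1 <= insert_row r b k /\
    insert_row r' (bump_row r b) k.+1 <= r k.+1.
  move=> h /=; have := hd k; have := r1 k; have := insert_row_ge k hr hb.
  by rewrite /bump_row /= !maxEle; do 2 case: ifPn; split; lra.
elim: m => [|m [h1 h2]].
  have h0 : insert_row r' (bump_row r b) 0 <= r 0%N by rewrite r0.
  by split=> //; exact: (step 0%N h0).1.
have [h3 h4] := step m h1.
by split=> //; exact: (step m.+1 h4).1.
Qed.

Definition zero_row : nat -> R := fun=> 0.

Fixpoint tableau T : Prop :=
  if T is r :: T' then
    [/\ is_row r, strictly_below (head zero_row T') r & tableau T']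
  else True.

Fixpoint reading T : seq (nat * R) :=
  if T is r :: T' then reading T' ++ row_blocks n r else [::].

Fixpoint insert_tableau T b : seq (nat -> R) :=
  if T is r :: T' then insert_row r b :: insert_tableau T' (bump_row r b)
  else [:: insert_row zero_row b].

Lemma is_row_head T : tableau T -> is_row (head zero_row T).
Proof. by case: T => [|r T] //= []. Qed.

Lemma head_insert_tableau T b :
  head zero_row (insert_tableau T b) = insert_row (head zero_row T) b.
Proof. by case: T. Qed.

Lemma tableau_insert T b : tableau T -> is_row b -> tableau (insert_tableau T b).
Proof.
elim: T b => [|r T IH] b /= => [_ hb|[hr hd hT] hb].
  split=> //; first exact: is_row_insert.
  by move=> m; apply: row_ge0; exact: is_row_insert.
split; first exact: is_row_insert.
  rewrite head_insert_tableau; apply: strictly_below_insert => //.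
  exact: is_row_head.
by apply: IH => //; exact: is_row_bump.
Qed.

Lemma insert_row0 b : is_row b -> insert_row zero_row b =1 b.
Proof.
move=> hb; elim=> [|m IH] /=; first by rewrite (proj1 hb).
by rewrite IH maxEle /zero_row; have := row_ge0 m hb; case: ifPn; lra.
Qed.

Lemma reading_insert T b : tableau T -> is_row b ->
  (reading T ++ row_blocks n b) ~~~ reading (insert_tableau T b).
Proof.
elim: T b => [|r T IH] b /= => [_ hb|[hr hd hT] hb].
  by rewrite (@eq_row_blocks _ _ _ b) // => m _; exact: insert_row0.
rewrite -catA.
apply: (block_equiv_trans (block_equiv_cat (block_equiv_refl _ _)
  (insert_row_blocks hr hb))).
rewrite catA; apply: block_equiv_cat => //; apply: IH => //.
exact: is_row_bump.
Qed.

Lemma tableau_exists l : block_word n l ->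
  exists2 T, tableau T & l ~~~ reading T.
Proof.
elim/last_ind: l => [_|l [c t] IH]; first by exists [::].
rewrite -cats1 block_word_cat => /andP[/IH[T hT hl] /andP[/andP[t0 _] /andP[hc _]]].
have /andP[c1 cn] := hc; rewrite /= in t0.
(* The row with the single block c^t, in cumulative form. *)
pose b m : R := if (m < c)%N then 0 else t.
have hb : is_row b.
  split; first by rewrite /b c1.
  by move=> m; rewrite /b; do 2 case: ltnP => // ?; try lia.
exists (insert_tableau T b); first exact: tableau_insert.
apply: (block_equiv_trans _ (reading_insert hT hb)).
apply: block_equiv_cat => //.
have hletter d : d \in iota 1 n -> (1 <= d <= n)%N by rewrite mem_iota; lia.
apply: (block_equiv_trans _ (fblocks_filter _ hletter)).
have multb d : mult b d = if d == c then t else 0.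
  rewrite /mult /b; case: (ltngtP d c) => hd.
  - have -> : (d.-1 < c)%N by lia.
    exact: subrr.
  - have -> : (d.-1 < c)%N = false by lia.
    exact: subrr.
  - by rewrite hd prednK // leqnn subr0.
have [t00|tn0] := eqVneq t 0.
  rewrite (@eq_filter _ _ pred0); last first.
    by move=> d; rewrite multb t00 if_same eqxx.
  rewrite filter_pred0 t00; exact/block_equiv1/block_zero.
rewrite (@eq_filter _ _ (pred1 c)); last first.
  by move=> d; rewrite multb /=; case: (d == c); rewrite ?tn0 ?eqxx.
rewrite filter_pred1_uniq ?iota_uniq //; last by rewrite mem_iota add1n ltnS.
by rewrite /= multb eqxx.
Qed.

End RowInsertion.

(** * Greene invariants of block words *)

Section Colourings.
Variable R : realType.
Implicit Types (l p q x : seq (nat * R)) (cl P X Q : seq (nat * R * nat)).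
Implicit Types (le : rel nat) (i j k a b c : nat) (t : R).

Definition chain i cl : seq nat := [seq e.1.1 | e <- cl & e.2 == i].

(* A colour i < k selects the i-th chain; blocks of colour >= k are not used. *)
Definition colouring le k cl : Prop := forall i, (i < k)%N -> pairwise le (chain i cl).

Definition covered k cl : R := \sum_(e <- cl | (e.2 < k)%N) e.1.2.

(** Compares weighted Greene invariants without suprema, one colouring at a time. The order is a
    parameter so that reversed words can be treated too. *)
Definition cover_le le l l' : Prop := forall k cl,
  [seq e.1 | e <- cl] = l -> colouring le k cl ->
  exists cl', [/\ [seq e.1 | e <- cl'] = l', colouring le k cl' &
    covered k cl <= covered k cl'].

Definition recolour (f : nat -> nat) cl := [seq (e.1, f e.2) | e <- cl].

Definition swap_colour (g h j : nat) : nat :=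
  if j == g then h else if j == h then g else j.

Lemma swap_colourK g h : involutive (swap_colour g h).
Proof.
move=> j; rewrite /swap_colour; case: (eqVneq j g) => [->|jg].
  by case: (eqVneq h g) => [->|_]; rewrite ?eqxx.
by case: (eqVneq j h) => [->|jh]; rewrite ?eqxx // (negPf jg) (negPf jh).
Qed.

Lemma recolour_fst f cl : [seq e.1 | e <- recolour f cl] = [seq e.1 | e <- cl].
Proof. by rewrite /recolour -map_comp; apply: eq_map. Qed.

Lemma chain_cat i P Q : chain i (P ++ Q) = chain i P ++ chain i Q.
Proof. by rewrite /chain filter_cat map_cat. Qed.

Lemma chain_cons i e Q :
  chain i (e :: Q) = (if e.2 == i then [:: e.1.1] else [::]) ++ chain i Q.
Proof. by rewrite /chain /=; case: ifP. Qed.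

Lemma chain_recolour i f cl :
  chain i (recolour f cl) = [seq e.1.1 | e <- cl & f e.2 == i].
Proof. by rewrite /chain filter_map -map_comp; apply: eq_map. Qed.

Lemma covered_cat k P Q : covered k (P ++ Q) = covered k P + covered k Q.
Proof. exact: big_cat. Qed.

Lemma covered_cons k e Q :
  covered k (e :: Q) = (if (e.2 < k)%N then e.1.2 else 0) + covered k Q.
Proof. by rewrite /covered big_cons; case: ifP => // _; rewrite add0r. Qed.

Lemma covered_nil k : covered k [::] = 0.
Proof. exact: big_nil. Qed.

Lemma covered_recolour k f cl : (forall j, (f j < k)%N = (j < k)%N) ->
  covered k (recolour f cl) = covered k cl.
Proof. by move=> h; rewrite /covered big_map; apply: eq_bigl => e /=. Qed.

Lemma map_eq_cat (A B : Type) (f : A -> B) (s : seq A) (u v : seq B) :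
  map f s = u ++ v ->
  exists s1 s2, [/\ s = s1 ++ s2, map f s1 = u & map f s2 = v].
Proof.
move=> h; exists (take (size u) s), (drop (size u) s).
by rewrite cat_take_drop map_take map_drop h take_size_cat // drop_size_cat.
Qed.

Lemma map_eq_cons (A B : Type) (f : A -> B) (s : seq A) y (v : seq B) :
  map f s = y :: v -> exists e s', [/\ s = e :: s', f e = y & map f s' = v].
Proof. by case: s => //= e s [<- <-]; exists e, s. Qed.

Lemma map_eq1 (A B : Type) (f : A -> B) (s : seq A) y :
  map f s = [:: y] -> exists2 e, s = [:: e] & f e = y.
Proof. by case: s => //= e [|//] [<-]; exists e. Qed.

(** * The exchange of one Knuth step, for any transitive relation *)

Section Exchange.
Variables (le : rel nat) (le_trans : transitive le).

Lemma pairwise_glue (A X D : seq nat) b :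
  pairwise le A -> pairwise le X -> pairwise le D ->
  allrel le A X -> all (le^~ b) A -> all (le^~ b) X -> all (le b) D ->
  pairwise le (A ++ X ++ b :: D).
Proof.
move=> hA hX hD /allrelP hAX /allP hAb /allP hXb /allP hbD.
have hbD' : all (le b) D by exact/allP.
rewrite !pairwise_cat /= hA hX hD hbD' !andbT /=; apply/andP; split.
  apply/allrelP => a e ha; rewrite mem_cat inE => /or3P[he|/eqP ->|he].
  - exact: hAX.
  - exact: hAb.
  - exact: le_trans (hAb _ ha) (hbD _ he).
apply/allrelP => a e ha; rewrite inE => /orP[/eqP ->|he]; first exact: hXb.
exact: le_trans (hXb _ ha) (hbD _ he).
Qed.

Lemma pairwise_glue0 (A D : seq nat) b : pairwise le A -> pairwise le D ->
  all (le^~ b) A -> all (le b) D -> pairwise le (A ++ b :: D).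
Proof.
by move=> hA hD hAb hbD; apply: (@pairwise_glue _ [::]); rewrite ?allrel0r.
Qed.

Lemma pairwise_chain i X : pairwise le (letters [seq e.1 | e <- X]) ->
  pairwise le (chain i X).
Proof.
rewrite /letters -map_comp /chain filter_mask map_mask.
exact: pairwise_mask.
Qed.

Lemma sub_chain i X (a : pred nat) : all a (letters [seq e.1 | e <- X]) ->
  all a (chain i X).
Proof.
rewrite /letters -map_comp /chain => /allP h; apply/allP => e /mapP[d].
by rewrite mem_filter => /andP[_ hd] ->; apply: h; apply/mapP; exists d.
Qed.

Variables (x p q : seq (nat * R)) (b c : nat) (t : R).
Hypotheses (hx : pairwise le (letters x ++ [:: b])) (hbc : le b c) (hcb : ~~ le c b).

Lemma pairwise_unglue (A X D : seq nat) d : pairwise le (A ++ X ++ d :: D) ->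
  [/\ [/\ pairwise le A, pairwise le X & pairwise le D],
      allrel le A X, all (le^~ d) A, all (le^~ d) X & all (le d) D].
Proof.
rewrite !pairwise_cat !allrel_catr !allrel_consr /=.
move=> /and3P[/and3P[h1 h2 h3] h4 /and3P[/andP[h5 h6] h7 /andP[h8 h9]]].
by split.
Qed.

(** The colours can be kept: a chain through the leading [c] meets no letter of [x], since these are
    below [b] and [c] is not. *)
Lemma exchange_back :
  cover_le le (p ++ ([:: (c, t)] ++ x ++ [:: (b, t)]) ++ q)
              (p ++ (x ++ [:: (c, t); (b, t)]) ++ q).
Proof.
move=> k cl /map_eq_cat[P [cl1 [-> hP /map_eq_cat[M [Q [-> hM hQ]]]]]].
have [[? gam] [cl2 [-> /= -> /map_eq_cat[X [cl3 [-> hX]]]]]] := map_eq_cons hM.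
move=> hM3; have [[? bet] -> /= ->] := map_eq1 hM3; move=> hk.
exists (P ++ (X ++ [:: (c, t, gam); (b, t, bet)]) ++ Q); split.
- by rewrite !map_cat hP hQ hX.
- move=> i hi; have := hk i hi; rewrite !(chain_cat, chain_cons) /= !cats0.
  have [_|_] := eqVneq gam i; last by [].
  move=> h; have X0 : chain i X = [::].
    have hXb : all (le^~ b) (chain i X).
      apply: sub_chain; rewrite hX.
      by move: hx; rewrite pairwise_cat allrel_consr => /and3P[/andP[]].
    move: h; rewrite pairwise_cat => /and3P[_ _ /= /andP[+ _]].
    case: (chain i X) hXb => //= d s /andP[h1 _] /andP[h2 _].
    by move: hcb; rewrite (le_trans h2 h1).
  by move: h; rewrite X0.
- by rewrite !(covered_cat, covered_cons, covered_nil) /=; lra.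
Qed.

(** Moving [c] in front of [x] breaks only the chain [gam] of [c], and only if this chain meets [x].
    Then [b] lies outside it, and as [b] and [c] have the same duration, trading their colours costs
    nothing. *)
Lemma exchange :
  cover_le le (p ++ (x ++ [:: (c, t); (b, t)]) ++ q)
              (p ++ ([:: (c, t)] ++ x ++ [:: (b, t)]) ++ q).
Proof.
move=> k cl /map_eq_cat[P [cl1 [-> hP /map_eq_cat[M [Q [-> hM hQ]]]]]].
have [X [cl2 [-> hX hM2]]] := map_eq_cat hM.
have [[? gam] [cl3 [-> /= ->]]] := map_eq_cons hM2.
move=> hM3; have [[? bet] -> /= ->] := map_eq1 hM3; move=> hk.
have hxx : pairwise le (letters x).
  by move: hx; rewrite pairwise_cat => /and3P[].
have hxb : all (le^~ b) (letters x).
  by move: hx; rewrite pairwise_cat allrel_consr => /and3P[/andP[]].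
have pwX i : pairwise le (chain i X) by apply: pairwise_chain; rewrite hX.
have Xb i : all (le^~ b) (chain i X) by apply: sub_chain; rewrite hX.
have [/andP[gamk Xn]|same] := boolP ((gam < k)%N && (chain gam X != [::])); last first.
  exists (P ++ ([:: (c, t, gam)] ++ X ++ [:: (b, t, bet)]) ++ Q); split.
  - by rewrite !map_cat hP hQ hX.
  - move=> i hi; have := hk i hi; rewrite !(chain_cat, chain_cons) /= !cats0.
    have [hg|//] := eqVneq gam i.
    by move: same; rewrite hg hi /= negbK => /eqP ->.
  - by rewrite !(covered_cat, covered_cons, covered_nil) /=; lra.
have hkg : pairwise le (chain gam P ++ chain gam X ++
    c :: (if bet == gam then [:: b] else [::]) ++ chain gam Q).
  by have := hk gam gamk; rewrite !(chain_cat, chain_cons) /= eqxx -!catA.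
have gb : bet != gam.
  apply/negP => hbg; move: hkg; rewrite hbg /= !pairwise_cat /=.
  by move=> /and3P[_ _ /and3P[_ _ /andP[/andP[]]]]; rewrite (negPf hcb).
move: hkg; rewrite (negPf gb) => /pairwise_unglue[[Pg _ Qg] PXg Pgc _ cQg].
have bQg : all (le b) (chain gam Q).
  by apply: sub_all cQg => d; apply: le_trans.
have Pgb : all (le^~ b) (chain gam P).
  move: Xn PXg (Xb gam); case: (chain gam X) => //= d s _ h /andP[hd _].
  move: h; rewrite allrel_consr => /andP[h _].
  by apply: sub_all h => e he; exact: le_trans he hd.
have [kbet|betk] := leqP k bet.
  exists (P ++ ([:: (c, t, bet)] ++ X ++ [:: (b, t, gam)]) ++ Q); split.
  - by rewrite !map_cat hP hQ hX.
  - move=> i hi; have := hk i hi; rewrite !(chain_cat, chain_cons) /= !cats0.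
    have -> : (bet == i) = false.
      by apply/eqP => bi; rewrite -bi ltnNge kbet in hi.
    have [<-|//] := eqVneq gam i; move=> _.
    rewrite -!catA; apply: pairwise_glue => //.
  - by rewrite !(covered_cat, covered_cons, covered_nil) /= gamk [(bet < k)%N]ltnNge kbet /=; lra.
have hkb : pairwise le (chain bet P ++ chain bet X ++ b :: chain bet Q).
  have := hk bet betk; rewrite !(chain_cat, chain_cons) /= eqxx.
  by rewrite [gam == bet]eq_sym (negPf gb) -!catA.
have [[Pb _ Qb] PXb Pbb _ bQb] := pairwise_unglue hkb.
(* If both chains meet x, the one that starts first in x takes all their letters
   of x, and the chain through b continues with it. *)
pose Xm := [seq e.1.1 | e <- X & (e.2 == gam) || (e.2 == bet)].
have pwXm : pairwise le Xm.
  rewrite /Xm filter_mask map_mask; apply: pairwise_mask.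
  by rewrite map_comp hX.
have Xmb : all (le^~ b) Xm.
  apply/allP => d /mapP[e]; rewrite mem_filter => /andP[_ he] ->.
  by apply: (allP hxb); rewrite -hX /letters -map_comp; apply/mapP; exists e.
(* [h] is the colour of the first letter of [Xm]. That letter is above the part of chain [h] in [P],
   and below the rest of [Xm] because [x] is increasing. *)
have Xm_head : exists2 h, (h == gam) || (h == bet) & allrel le (chain h P) Xm.
  have : exists2 e, e \in X & (e.2 == gam) || (e.2 == bet).
    move: Xn; rewrite /chain; case E : [seq e <- X | _] => [//|e s] _.
    exists e; last first.
      have : e \in [seq e <- X | e.2 == gam] by rewrite E mem_head.
      by rewrite mem_filter => /andP[->].
    have : e \in [seq e <- X | e.2 == gam] by rewrite E mem_head.
    by rewrite mem_filter => /andP[].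
  rewrite /Xm; case E : [seq e <- X | _] => [|e0 E0].
    move=> [e he hc]; have : e \in [seq e <- X | (e.2 == gam) || (e.2 == bet)].
      by rewrite mem_filter hc.
    by rewrite E.
  move=> _; have : e0 \in [seq e <- X | (e.2 == gam) || (e.2 == bet)].
    by rewrite E mem_head.
  rewrite mem_filter => /andP[he0 e0X]; exists e0.2 => //.
  have hP0 : all (le^~ e0.1.1) (chain e0.2 P).
    have PX : allrel le (chain e0.2 P) (chain e0.2 X) by case/orP: he0 => /eqP ->.
    apply/allP => d hd; move/allrelP: PX; apply=> //.
    by apply/mapP; exists e0; rewrite ?mem_filter ?eqxx.
  rewrite /= allrel_consr hP0 /=.
  move: pwXm; rewrite /Xm E /= => /andP[/allP h1 _].
  apply/allrelP => d e hd he; exact: le_trans (allP hP0 _ hd) (h1 _ he).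
pose merge h j := if (j == gam) || (j == bet) then h else j.
pose swap := swap_colour gam bet.
have chain_merge h i : (h == gam) || (h == bet) ->
    chain i (recolour (merge h) X) =
    if i == h then Xm else if (i == gam) || (i == bet) then [::] else chain i X.
  move=> hh; rewrite chain_recolour /merge.
  have [->|ih] := eqVneq i h.
    congr map; apply: eq_filter => e; case: ifP; rewrite ?eqxx // => hn.
    by apply/eqP => eh; rewrite eh hh in hn.
  have [ig|ig] := boolP ((i == gam) || (i == bet)).
    rewrite (@eq_filter _ _ pred0) ?filter_pred0 // => e /=.
    case: ifP => hn; first by rewrite eq_sym (negPf ih).
    by apply/eqP => ei; rewrite ei ig in hn.
  congr map; apply: eq_filter => e; case: ifP => // hn.
  rewrite eq_sym (negPf ih); apply/esym/eqP => ei.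
  by rewrite ei (negPf ig) in hn.
have chain_swap i : chain i (recolour swap Q) = chain (swap i) Q.
  by rewrite chain_recolour; congr map; apply: eq_filter => e; rewrite -(inv_eq (swap_colourK _ _)).
have merge_k h : (h == gam) || (h == bet) -> forall j, (merge h j < k)%N = (j < k)%N.
  move=> hh j; rewrite /merge; case: ifP => // hj.
  by case/orP: hh => /eqP ->; case/orP: hj => /eqP ->; rewrite ?gamk ?betk.
have swap_k j : (swap j < k)%N = (j < k)%N.
  rewrite /swap /swap_colour; have [->|_] := eqVneq j gam; first by rewrite gamk betk.
  by have [->|_] := eqVneq j bet; rewrite ?gamk ?betk.
have [h hh PXm] := Xm_head.
(* If [gam] comes first, the tails are swapped: [gam] goes on with [Xm], [b] and the old tail of
   [bet], while [bet] goes on with [c] and the old tail of [gam]. *)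
have [hg|hb] := eqVneq h gam.
  exists (P ++ ([:: (c, t, bet)] ++ recolour (merge gam) X ++ [:: (b, t, gam)]) ++
    recolour swap Q); split.
  - by rewrite !map_cat !recolour_fst hP hQ hX.
  - move=> i hi; have := hk i hi; rewrite !(chain_cat, chain_cons) /= !cats0.
    rewrite chain_merge ?eqxx // chain_swap /swap /swap_colour.
    have [ig _|ig] := eqVneq gam i.
      rewrite -?ig (negPf gb) -!catA; apply: pairwise_glue => //.
      by rewrite -hg.
    have [ib _|ib] := eqVneq bet i; last by [].
    rewrite -?ib /=; apply: pairwise_glue0 => //.
    by apply: sub_all Pbb => d hd; exact: le_trans hd hbc.
  - have mg : (gam == gam) || (gam == bet) by rewrite eqxx.
    rewrite !(covered_cat, covered_cons, covered_nil) /=.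
    rewrite (covered_recolour _ (merge_k _ mg)) (covered_recolour _ swap_k).
    by rewrite gamk betk; lra.
(* If [bet] comes first, the tails stay: [Xm] goes to [bet], before [b], and [gam] passes directly
   to [c]. *)
exists (P ++ ([:: (c, t, gam)] ++ recolour (merge bet) X ++ [:: (b, t, bet)]) ++ Q).
have {}hb : h = bet by move: hh; rewrite (negPf hb) => /eqP.
split.
- by rewrite !map_cat !recolour_fst hP hQ hX.
- move=> i hi; have := hk i hi; rewrite !(chain_cat, chain_cons) /= !cats0.
  rewrite chain_merge ?eqxx ?orbT //.
  have [ib _|ib] := eqVneq bet i.
    rewrite -?ib [gam == bet]eq_sym (negPf gb) -!catA; apply: pairwise_glue => //.
    by rewrite -hb.
  have [ig _|ig //] := eqVneq gam i.
  by rewrite -?ig /=; apply: pairwise_glue0.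
- have mb : (bet == gam) || (bet == bet) by rewrite eqxx orbT.
  rewrite !(covered_cat, covered_cons, covered_nil) /=.
  by rewrite (covered_recolour _ (merge_k _ mb)) gamk betk; lra.
Qed.

End Exchange.
End Colourings.

(** * Both Knuth relations; chains of blocks as unions of intervals *)

Section Greene.
Variable R : realType.
Implicit Types (l p q x : seq (nat * R)) (cl : seq (nat * R * nat)).
Implicit Types (i j k a b c : nat) (s t o : R).

Lemma chain_rev i cl : chain i (rev cl) = rev (chain i cl).
Proof. by rewrite /chain filter_rev map_rev. Qed.

Lemma geq_trans : transitive geq.
Proof. by move=> y x z h1 h2; exact: leq_trans h2 h1. Qed.

Lemma pairwise_geq_rev (s : seq nat) : pairwise geq (rev s) = pairwise leq s.
Proof.
rewrite -(sorted_pairwise geq_trans) -(sorted_pairwise leq_trans) rev_sorted.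
by [].
Qed.

Lemma cover_le_rev l l' : cover_le geq (rev l) (rev l') -> cover_le leq l l'.
Proof.
move=> h k cl hcl hk; have [||cl' [h1 h2 h3]] := h k (rev cl).
- by rewrite map_rev hcl.
- by move=> i hi; rewrite chain_rev pairwise_geq_rev; apply: hk.
exists (rev cl'); split.
- by rewrite map_rev h1 revK.
- by move=> i hi; rewrite -pairwise_geq_rev chain_rev revK; apply: h2.
- move: h3; rewrite /covered big_rev => /le_trans; apply.
  by rewrite big_rev.
Qed.

Lemma cover_knuth1 p q x b c t : pairwise leq (letters x ++ [:: b]) -> (b < c)%N ->
  cover_le leq (p ++ (x ++ [:: (c, t); (b, t)]) ++ q)
               (p ++ ([:: (c, t)] ++ x ++ [:: (b, t)]) ++ q) /\
  cover_le leq (p ++ ([:: (c, t)] ++ x ++ [:: (b, t)]) ++ q)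
               (p ++ (x ++ [:: (c, t); (b, t)]) ++ q).
Proof.
move=> hx hbc; have hcb : ~~ (c <= b)%N by rewrite -ltnNge.
by split; [apply: exchange|apply: exchange_back] => //; first exact: leq_trans;
  try exact: ltnW; exact: leq_trans.
Qed.

(** Reversed, b a z reads [rev z], a, b, a row for [geq] followed by two letters: this is the
    exchange with [rev z] for [x] and [a] for [c]. *)
Lemma cover_knuth2 p q z a b t : pairwise leq (b :: letters z) -> (a < b)%N ->
  cover_le leq (p ++ ([:: (b, t); (a, t)] ++ z) ++ q)
               (p ++ ([:: (b, t)] ++ z ++ [:: (a, t)]) ++ q) /\
  cover_le leq (p ++ ([:: (b, t)] ++ z ++ [:: (a, t)]) ++ q)
               (p ++ ([:: (b, t); (a, t)] ++ z) ++ q).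
Proof.
move=> hz hab; have hba : ~~ (a >= b)%N by rewrite -ltnNge.
have hz' : pairwise geq (letters (rev z) ++ [:: b]).
  rewrite /letters map_rev -/(letters z) -[[:: b]]/(rev [:: b]) -rev_cat.
  by rewrite pairwise_geq_rev.
by split; apply: cover_le_rev; rewrite !rev_cat -!catA;
  [have := @exchange R geq geq_trans (rev z) (rev q) (rev p) b a t hz' (ltnW hab) hba
  |have := @exchange_back R geq geq_trans (rev z) (rev q) (rev p) b a t hz' hba];
  rewrite -!catA.
Qed.

Lemma weakly_increasing_blocks l : nonneg l -> pairwise leq (letters l) ->
  weakly_increasing (blocks l).
Proof.
elim: l => [|[c t] l IH] /=; first by move=> _ _ s r; rewrite /=; lra.
move=> /andP[ht hl] /andP[/allP hc hp] s r s0 sr /= hr.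
have hw := wlen_blocks l.
have hin u : 0 <= u < weight l -> blocks l u \in letters l.
  elim: (l) u hl => [|[d v] l' IH'] u /=; first by rewrite weight_nil; lra.
  move=> /andP[hv hl'] hu; rewrite weight_cons /= in hu.
  case: ltP => h; first by rewrite ifT ?mem_head //; lra.
  by rewrite inE IH' ?orbT //; lra.
case: (ltP s t) => hs; case: (ltP r t) => hr'.
- by rewrite !ifT //; lra.
- rewrite ifT; last by lra.
  by apply/hc/hin; lra.
- lra.
- by apply: IH => //; lra.
Qed.

(** Zero blocks are skipped because [interval_union] admits only nonempty intervals. *)
Fixpoint colour_itvs i o cl : seq (R * R) :=
  if cl is e :: cl' then
    (if (e.2 == i) && (0 < e.1.2) then [:: (o, o + e.1.2)] else [::])
    ++ colour_itvs i (o + e.1.2) cl'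
  else [::].

Lemma colour_itvs_in i o cl ab : nonneg [seq e.1 | e <- cl] ->
  ab \in colour_itvs i o cl ->
  [/\ o <= ab.1, ab.1 < ab.2 & ab.2 <= o + weight [seq e.1 | e <- cl]].
Proof.
elim: cl o => [|e cl IH] o //= /andP[he hcl]; have hw := weight_ge0 hcl.
rewrite weight_cons mem_cat => /orP[|/IH-/(_ hcl)[h1 h2 h3]]; last by split; lra.
by case: ifP => // /andP[_ h]; rewrite inE => /eqP -> /=; split; lra.
Qed.

Lemma colour_itvs_union i o cl : nonneg [seq e.1 | e <- cl] -> 0 <= o ->
  interval_union (o + weight [seq e.1 | e <- cl]) (colour_itvs i o cl).
Proof.
move=> hcl o0; apply/andP; split.
  by apply/allP => ab /(colour_itvs_in hcl)[h1 h2 h3]; lra.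
elim: cl o {o0} hcl => [|e cl IH] o //= /andP[he hcl].
rewrite pairwise_cat IH // andbT; apply/andP; split; last by case: ifP.
apply/allrelP => ab cd; case: ifP => // _; rewrite inE => /eqP -> /=.
by move=> /(colour_itvs_in hcl)[].
Qed.

Lemma support_ofP (S : seq (R * R)) t :
  support_of S t <-> exists2 ab, ab \in S & ab.1 <= t < ab.2.
Proof.
split=> [[ab /= hab]|[ab hab ht]]; first by rewrite in_itv /= => ht; exists ab.
by exists ab => //=; rewrite in_itv.
Qed.

Lemma colour_itvs_disjoint i j o cl t : nonneg [seq e.1 | e <- cl] ->
  support_of (colour_itvs i o cl) t -> support_of (colour_itvs j o cl) t -> i = j.
Proof.
elim: cl o => [|e cl IH] o /= hcl; first by move=> /support_ofP[].
have /andP[he hcl'] := hcl.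
move=> /support_ofP[ab hab ht] /support_ofP[cd hcd ht'].
move: hab hcd; rewrite !mem_cat => /orP hab /orP hcd.
case: hab => hab; case: hcd => hcd; move: hab hcd.
- by case: ifP => // /andP[/eqP <- _] _; case: ifP => // /andP[/eqP <-].
- case: ifP => // _; rewrite inE => /eqP e1 hcd; rewrite e1 /= in ht.
  by exfalso; have [] := colour_itvs_in hcl' hcd; lra.
- move=> hab; case: ifP => // _; rewrite inE => /eqP e1; rewrite e1 /= in ht'.
  by exfalso; have [] := colour_itvs_in hcl' hab; lra.
- by move=> hab hcd; apply: (IH (o + e.1.2)) => //; apply/support_ofP; [exists ab|exists cd].
Qed.

Definition chain_blocks i cl := [seq e.1 | e <- cl & (e.2 == i) && (0 < e.1.2)].

Lemma tsubword_colour (w : tword R) i o cl : nonneg [seq e.1 | e <- cl] ->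
  (forall s, 0 <= s < weight [seq e.1 | e <- cl] ->
     w (o + s) = blocks [seq e.1 | e <- cl] s) ->
  tsubword w (colour_itvs i o cl) = blocks (chain_blocks i cl).
Proof.
elim: cl o => [|e cl IH] o //= /andP[he hcl]; rewrite weight_cons /chain_blocks => hw.
have hw0 := weight_ge0 hcl.
have {}IH : tsubword w (colour_itvs i (o + e.1.2) cl) = blocks (chain_blocks i cl).
  apply: IH => // s hs; rewrite -addrA hw; last by lra.
  by rewrite /= ifF; [congr (blocks _ _); ring|apply/negP; lra].
rewrite /=; case: ifP => [/andP[_ e0]|_] /=; last exact: IH.
rewrite IH; congr (_ * _)%TW.
apply: tword_ext => /= [|s]; first by ring.
have -> : o + e.1.2 - o = e.1.2 by ring.
case: ifP => // hs.
rewrite hw; last by lra.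
by rewrite /= !ifT //; lra.
Qed.

Lemma sum_chain_blocks k cl : nonneg [seq e.1 | e <- cl] ->
  \sum_(i < k) weight (chain_blocks i cl) = covered k cl.
Proof.
elim: cl => [|e cl IH] /=.
  by move=> _; rewrite covered_nil big1 // => i _; rewrite /chain_blocks /= weight_nil.
move=> /andP[he hcl]; rewrite covered_cons -IH //.
have E i : weight (chain_blocks i (e :: cl)) =
    (if e.2 == i then e.1.2 else 0) + weight (chain_blocks i cl).
  rewrite /chain_blocks /=; case: eqP => _ /=; last by rewrite add0r.
  case: ltP => h /=; first by rewrite weight_cons.
  have -> : e.1.2 = 0 by lra.
  by rewrite add0r.
under eq_bigr => i _ do rewrite E.
rewrite big_split /=; congr (_ + _); case: ltnP => h.
  rewrite (bigD1 (Ordinal h)) //= eqxx big1 ?addr0 // => i hi.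
  by rewrite ifN //; apply: contra hi => /eqP hi; apply/eqP/val_inj; rewrite /= hi.
by apply: big1 => i _; case: eqP => // hi; move: (ltn_ord i); rewrite -hi ltnNge h.
Qed.

End Greene.

(** * Rounding families of intervals to whole blocks *)

Section GreeneBlocks.
Variable R : realType.
Implicit Types (l p q x : seq (nat * R)) (cl : seq (nat * R * nat)).
Implicit Types (i j k a b c : nat) (s t o : R) (w : tword R).

Local Notation mu := (@lebesgue_measure R).

Lemma wlen_tsubword w (S : seq (R * R)) :
  wlen (tsubword w S) = \sum_(ab <- S) (ab.2 - ab.1).
Proof. by elim: S => [|ab S IH] /=; rewrite ?big_nil ?big_cons ?IH. Qed.

Lemma support_of_cons ab (S : seq (R * R)) :
  support_of (ab :: S) = `[ab.1, ab.2[%classic `|` support_of S.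
Proof.
apply/seteqP; split=> t.
  move=> /support_ofP[cd]; rewrite inE => /orP[/eqP ->|h] ht.
    by left; rewrite /= in_itv.
  by right; apply/support_ofP; exists cd.
case=> [|/support_ofP[cd h ht]]; last first.
  by apply/support_ofP; exists cd; rewrite ?inE ?h ?orbT.
by rewrite /= in_itv /= => ht; apply/support_ofP; exists ab; rewrite ?mem_head.
Qed.

Lemma support_of_nil : support_of (nil : seq (R * R)) = set0.
Proof. by apply/seteqP; split=> // t /support_ofP[]. Qed.

Lemma measurable_support (S : seq (R * R)) : measurable (support_of S).
Proof.
elim: S => [|ab S IH]; first by rewrite support_of_nil; exact: measurable0.
rewrite support_of_cons; apply: measurableU => //; exact: measurable_itv.
Qed.

Lemma measure_itv_co (a b : R) : a <= b -> mu `[a, b[%classic = (b - a)%:E.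
Proof.
move=> ab; rewrite lebesgue_measure_itv /= lte_fin; case: ltP => h //.
by have -> : b - a = 0 by lra.
Qed.

Lemma interval_union_cons r ab (S : seq (R * R)) : interval_union r (ab :: S) ->
  [/\ ab.1 < ab.2, interval_union r S & {in S, forall cd, ab.2 <= cd.1}].
Proof.
move=> /andP[/= /andP[/and3P[_ h _] hS] /andP[/allP hlt hp]].
by split=> //; apply/andP.
Qed.

Lemma wlen_tsubword_ge0 r w (S : seq (R * R)) : interval_union r S ->
  0 <= wlen (tsubword w S).
Proof.
move=> /andP[/allP h _]; rewrite wlen_tsubword big_seq sumr_ge0 // => cd /h; lra.
Qed.

Lemma measure_support r (S : seq (R * R)) : interval_union r S ->
  mu (support_of S) = (\sum_(ab <- S) (ab.2 - ab.1))%:E.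
Proof.
elim: S => [|ab S IH]; first by rewrite support_of_nil measure0 big_nil.
move=> /interval_union_cons[hab hS hlt].
rewrite support_of_cons big_cons EFinD -(IH hS).
rewrite -measure_itv_co; last by lra.
apply: measureU; [exact: measurable_itv|exact: measurable_support|].
apply/seteqP; split=> // t [] /=; rewrite in_itv /= => ht /support_ofP[cd /hlt hcd].
by lra.
Qed.

Lemma tsubword_point r w (S : seq (R * R)) s t : interval_union r S ->
  support_of S s -> support_of S t -> s <= t ->
  exists u v, [/\ 0 <= u, u <= v, v < wlen (tsubword w S),
    tsubword w S u = w s & tsubword w S v = w t].
Proof.
elim: S s t => [|ab S IH] s t; first by rewrite support_of_nil.
move=> /interval_union_cons[hab hS hlt].
have {}IH := IH _ _ hS.
have gt_b (y : R) : support_of S y -> ab.2 <= y.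
  by move=> /support_ofP[cd /hlt hcd]; lra.
have wl0 := wlen_tsubword_ge0 w hS.
rewrite support_of_cons => -[|hs]; [rewrite /= in_itv /= => hs|];
  (case=> [|ht]; [rewrite /= in_itv /= => ht|]) => st.
- exists (s - ab.1), (t - ab.1); split=> /=; [lra|lra|lra| |].
    by rewrite !ifT; [congr (w _); ring|lra|lra].
  by rewrite !ifT; [congr (w _); ring|lra|lra].
- have [u [v [u0 uv vl _ hv]]] := IH t t ht ht (lexx t).
  exists (s - ab.1), (ab.2 - ab.1 + v); split=> /=; [lra|lra|lra| |].
    by rewrite !ifT; [congr (w _); ring|lra|lra].
  rewrite ifF; last by apply/negP; lra.
  by rewrite -hv; congr (tsubword w S _); ring.
- by exfalso; have := gt_b s hs; lra.
- have [u [v [u0 uv vl hu hv]]] := IH s t hs ht st.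
  exists (ab.2 - ab.1 + u), (ab.2 - ab.1 + v); split=> /=; [lra|lra|lra| |].
    rewrite ifF; last by apply/negP; lra.
    by rewrite -hu; congr (tsubword w S _); ring.
  rewrite ifF; last by apply/negP; lra.
  by rewrite -hv; congr (tsubword w S _); ring.
Qed.

(** Turns monotonicity of the concatenated subword into a condition on the points of the support, in
    the time scale of [w], where it can be compared with the blocks. *)
Lemma tsubword_mono r w (S : seq (R * R)) s t : interval_union r S ->
  weakly_increasing (tsubword w S) ->
  support_of S s -> support_of S t -> s <= t -> (w s <= w t)%N.
Proof.
move=> hS hw hs ht st.
have [u [v [u0 uv vl <- <-]]] := tsubword_point w hS hs ht st.
exact: hw.
Qed.

Section Touch.
Variables (k : nat) (S : 'I_k -> seq (R * R)).

Definition touch (a b : R) : nat :=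
  if [pick i : 'I_k | `[< exists2 s, a <= s < b & support_of (S i) s >]] is Some i
  then i else k.

Fixpoint touch_colour o l : seq (nat * R * nat) :=
  if l is e :: l' then (e, touch o (o + e.2)) :: touch_colour (o + e.2) l'
  else [::].

Lemma touch_colour_fst o l : [seq e.1 | e <- touch_colour o l] = l.
Proof. by elim: l o => [|e l IH] o //=; rewrite IH. Qed.

Lemma touchP (a b : R) (i : 'I_k) : touch a b = i ->
  exists2 s, a <= s < b & support_of (S i) s.
Proof.
rewrite /touch; case: pickP => [j /asboolP hj /ord_inj <- //|_ hk].
by have := ltn_ord i; rewrite -hk ltnn.
Qed.

Lemma touch_lt (a b : R) s (i : 'I_k) : a <= s < b -> support_of (S i) s ->
  (touch a b < k)%N.
Proof.
move=> hs hi; rewrite /touch; case: pickP => [j _|/(_ i)/asboolP[]]; first exact: ltn_ord.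
by exists s.
Qed.

Lemma touch_chain_point w o l (i : 'I_k) c : nonneg l ->
  (forall s, 0 <= s < weight l -> w (o + s) = blocks l s) ->
  c \in chain i (touch_colour o l) ->
  exists s, [/\ o <= s, support_of (S i) s & w s = c].
Proof.
elim: l o => [|e l IH] o //= /andP[he hl]; rewrite weight_cons => hw.
have hw0 := weight_ge0 hl.
rewrite chain_cons mem_cat => /orP[|hc].
  case: eqP => //= /touchP[s hs hi]; rewrite inE => /eqP ->.
  exists s; split=> //; first by lra.
  have -> : s = o + (s - o) by ring.
  by rewrite hw /= ?ifT //; lra.
have [|s [h1 h2 h3]] := IH (o + e.2) hl _ hc.
  move=> s hs; rewrite -addrA hw; last by lra.
  by rewrite /= ifF; [congr (blocks _ _); ring|apply/negP; lra].
by exists s; split=> //; lra.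
Qed.

Lemma touch_chain_sorted w o l (i : 'I_k) : nonneg l ->
  (forall s, 0 <= s < weight l -> w (o + s) = blocks l s) ->
  (forall s t, support_of (S i) s -> support_of (S i) t -> s <= t -> (w s <= w t)%N) ->
  pairwise leq (chain i (touch_colour o l)).
Proof.
move=> hl hw hmono; elim: l o hl hw => [|e l IH] o //= /andP[he hl].
rewrite weight_cons => hw; have hw0 := weight_ge0 hl.
have hw' s : 0 <= s < weight l -> w (o + e.2 + s) = blocks l s.
  move=> hs; rewrite -addrA hw; last by lra.
  by rewrite /= ifF; [congr (blocks _ _); ring|apply/negP; lra].
rewrite chain_cons pairwise_cat (IH (o + e.2)) // andbT.
case: eqP => //= /touchP[s hs hi]; rewrite andbT allrel1l; apply/allP => c hc.
have [t [h1 h2 <-]] := touch_chain_point hl hw' hc.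
have <- : w s = e.1.
  have -> : s = o + (s - o) by ring.
  by rewrite hw /= ?ifT //; lra.
by apply: hmono => //; lra.
Qed.

(** Block by block: the part of [U] in a touched block measures at most the duration of the block,
    and an untouched block contains no point of [U]. *)
Lemma touch_covered (U : set R) o l : nonneg l -> measurable U ->
  (forall s, U s -> exists i : 'I_k, support_of (S i) s) ->
  (mu (U `&` `[o, (o + weight l)%R[%classic) <= (covered k (touch_colour o l))%:E)%E.
Proof.
move=> hl mU hU; elim: l o hl => [|e l IH] o /=.
  move=> _; rewrite weight_nil addr0 covered_nil.
  have -> : `[o, o[%classic = set0 :> set R.
    by apply/seteqP; split=> // s /=; rewrite in_itv /=; lra.
  by rewrite setI0 measure0.
move=> /andP[he hl]; rewrite weight_cons covered_cons EFinD.
have mI (a b : R) : measurable (U `&` `[a, b[%classic).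
  by apply: measurableI => //; exact: measurable_itv.
apply: (@le_trans _ _ (mu (U `&` `[o, (o + e.2)%R[%classic) +
    mu (U `&` `[(o + e.2)%R, (o + e.2 + weight l)%R[%classic))%E).
  apply: le_trans (measureU2 _ _ _); [|exact: mI|exact: mI].
  apply: le_measure; rewrite ?inE; [exact: mI|by apply: measurableU; exact: mI|].
  move=> s [hs] /=; rewrite !in_itv /= => hso.
  by case: (ltP s (o + e.2)) => h; [left|right]; split=> //=; rewrite ?in_itv /=; lra.
apply: leeD; last exact: IH.
case: ltnP => ht.
  rewrite (_ : (e.2)%:E = mu `[o, o + e.2[%classic); last first.
    by rewrite measure_itv_co; [congr (_%:E); ring|lra].
  apply: le_measure; rewrite ?inE; [exact: mI|exact: measurable_itv|].
  exact: subIsetr.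
rewrite (_ : U `&` _ = set0) ?measure0 //.
apply/seteqP; split=> // s [/hU[i hi]] /=; rewrite in_itv /= => hs.
by move: ht; rewrite leqNgt (touch_lt hs hi).
Qed.

(** Measure adds up the lengths of the disjoint supports without any analysis of how their intervals
    interleave. *)
Lemma touch_sum r : (forall i : 'I_k, interval_union r (S i)) ->
  trivIset [set: 'I_k] (fun i : 'I_k => support_of (S i)) ->
  exists U : set R, [/\ measurable U,
    (forall s, U s <-> exists i : 'I_k, support_of (S i) s) &
    mu U = (\sum_(i < k) \sum_(ab <- S i) (ab.2 - ab.1))%:E].
Proof.
move=> hS hT.
(* The family is extended by the empty set to all natural numbers, to fit additivity of measures
   over sequences. *)
pose F j := if insub j is Some i then support_of (S i) else set0.
have FE (i : 'I_k) : F i = support_of (S i) by rewrite /F valK.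
have mF j : measurable (F j).
  by rewrite /F; case: insub => [i|]; [exact: measurable_support|exact: measurable0].
have mU : measurable (\big[setU/set0]_(i < k) F i) by exact: bigsetU_measurable.
exists (\big[setU/set0]_(i < k) F i); split=> //.
  move=> s; rewrite -bigcup_mkord; split=> [[j /= hj]|[i hi]].
    by rewrite -[j]/(val (Ordinal hj)) FE => hs; exists (Ordinal hj).
  by exists (val i) => /=; rewrite ?ltn_ord ?FE.
rewrite measure_bigsetU //.
  rewrite -sumEFin; apply: eq_bigr => i _; rewrite FE.
  exact: measure_support (hS i).
move=> i j _ _ [s []]; rewrite /F.
case: insubP => [i' _ <-|//]; case: insubP => [j' _ <-|//] h1 h2.
by congr val; apply: (hT i' j') => //; exists s.
Qed.

End Touch.

End GreeneBlocks.

(** * Greene invariants as maxima over colourings, and their invariance *)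

Section GreeneCover.
Variable R : realType.
Implicit Types (l p q x : seq (nat * R)) (cl : seq (nat * R * nat)) (k n : nat).

Lemma covered_le_weight k cl : nonneg [seq e.1 | e <- cl] ->
  covered k cl <= weight [seq e.1 | e <- cl].
Proof.
elim: cl => [|e cl IH] /=; first by rewrite covered_nil weight_nil.
move=> /andP[he /IH h]; rewrite covered_cons weight_cons.
by apply: lerD => //; case: ifP.
Qed.

Lemma greene_cover k l (S : 'I_k -> seq (R * R)) : nonneg l ->
  (forall i, interval_union (wlen (blocks l)) (S i)) ->
  trivIset [set: 'I_k] (fun i => support_of (S i)) ->
  (forall i, weakly_increasing (tsubword (blocks l) (S i))) ->
  exists cl, [/\ [seq e.1 | e <- cl] = l, colouring leq k cl &
    \sum_(i < k) wlen (tsubword (blocks l) (S i)) <= covered k cl].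
Proof.
move=> hl hS hT hW; exists (touch_colour S 0 l); split.
- exact: touch_colour_fst.
- move=> i hi; apply: (@touch_chain_sorted R k S (blocks l) 0 l (Ordinal hi)) => //.
    by move=> s _; rewrite add0r.
  by move=> s t; apply: tsubword_mono.
have [U [mU hU muU]] := touch_sum hS hT.
have := touch_covered 0 hl mU (fun s => (hU s).1).
rewrite add0r setIidl.
  rewrite muU lee_fin; apply: le_trans; apply: ler_sum => i _.
  by rewrite wlen_tsubword.
move=> s /hU[i /support_ofP[ab hab hs]]; rewrite /= in_itv /=.
have /andP[/allP/(_ _ hab)] := hS i; rewrite wlen_blocks; lra.
Qed.

Lemma greene_le k l M : nonneg l ->
  (forall cl, [seq e.1 | e <- cl] = l -> colouring leq k cl -> covered k cl <= M) ->
  greene k (blocks l) <= M.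
Proof.
move=> hl hM; apply: ge_sup.
  exists 0, (fun=> [::]); split=> //=.
  - by move=> i j _ _ [s]; rewrite support_of_nil => -[].
  - by apply/esym/big1.
move=> y [S [h1 h2 h3 ->]].
have [cl [e1 e2 e3]] := greene_cover hl h1 h2 h3.
exact: le_trans e3 (hM _ e1 e2).
Qed.

Lemma greene_ge k cl : nonneg [seq e.1 | e <- cl] -> colouring leq k cl ->
  covered k cl <= greene k (blocks [seq e.1 | e <- cl]).
Proof.
move=> hl hk; apply: ub_le_sup.
  (* The total duration bounds the set from above, so [sup] is not a default value. *)
  exists (weight [seq e.1 | e <- cl]) => y [S [h1 h2 h3 ->]].
  have [cl' [e1 e2 e3]] := greene_cover hl h1 h2 h3.
  apply: (le_trans e3); rewrite -[in X in _ <= X]e1; apply: covered_le_weight.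
  by rewrite e1.
have hts i : tsubword (blocks [seq e.1 | e <- cl]) (colour_itvs i 0 cl) =
    blocks (chain_blocks i cl).
  by apply: tsubword_colour => // s _; rewrite add0r.
exists (fun i => colour_itvs i 0 cl); split.
- move=> i; rewrite wlen_blocks -[weight _]add0r.
  exact: colour_itvs_union.
- move=> i j _ _ [s [h1 h2]]; apply: val_inj.
  exact: colour_itvs_disjoint hl h1 h2.
- move=> i; rewrite hts; apply: weakly_increasing_blocks.
    apply/allP => e /mapP[d]; rewrite mem_filter => /andP[_ hd] ->.
    by apply: (allP hl); exact: map_f.
  have -> : letters (chain_blocks i cl) =
      [seq e.1.1 | e <- [seq e <- [seq e <- cl | e.2 == i :> nat] | 0 < e.1.2]].
    rewrite /letters /chain_blocks -map_comp -filter_predI; congr map.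
    by apply: eq_filter => e /=; rewrite andbC.
  rewrite filter_mask map_mask; apply: pairwise_mask.
  exact: hk (ltn_ord i).
- by under eq_bigr => i _ do rewrite hts wlen_blocks; rewrite sum_chain_blocks.
Qed.

Lemma cover_le_greene k l l' : nonneg l -> nonneg l' -> cover_le leq l l' ->
  greene k (blocks l) <= greene k (blocks l').
Proof.
move=> hl hl' h; apply: greene_le => // cl e1 e2.
have [cl' [h1 h2 h3]] := h k cl e1 e2.
by apply: (le_trans h3); rewrite -h1; apply: greene_ge; rewrite ?h1.
Qed.

Lemma tconst0 c : tconst c 0 = tempty R.
Proof. by apply: tword_ext => //= s; rewrite ifF //; apply/negP; lra. Qed.

Lemma tconstD c s t : 0 <= s -> 0 <= t ->
  (tconst c s * tconst c t)%TW = tconst c (s + t) :> tword R.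
Proof.
move=> s0 t0; apply: tword_ext => //= u.
case: (ltP u s) => h; first by case: (leP 0 u) => h'; rewrite /= ?ifT //; lra.
case: ifP => h'; first by rewrite ifT //; lra.
by rewrite ifF //; apply/negP; move/negP: h'; lra.
Qed.

Lemma blocks_cons e l : blocks (e :: l) = (tconst e.1 e.2 * blocks l)%TW.
Proof. by []. Qed.

Lemma block_step_cases n l l' : block_step n l l' -> block_word n l ->
  blocks l = blocks l' \/ (forall p q, cover_le leq (p ++ l ++ q) (p ++ l' ++ q) /\
    cover_le leq (p ++ l' ++ q) (p ++ l ++ q)).
Proof.
case=> [c hc|c s t s0 t0|x b c t hx hbc|z a b t hz hab] hl.
- by left; rewrite blocks1 tconst0.
- left; rewrite blocks_cons !blocks1 /=; exact: tconstD.
- by right=> p q; exact: cover_knuth1.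
- by right=> p q; exact: cover_knuth2.
Qed.

Lemma block_equiv_greene n k l l' : block_equiv n l l' -> block_word n l ->
  greene k (blocks l) = greene k (blocks l').
Proof.
elim=> {l l'} [p q l l' h|l|l l' hh IH|l' l l'' h1 IH1 h2 IH2] hl //.
- have hl' : block_word n (p ++ l' ++ q).
    by move: hl; rewrite !block_word_cat (block_step_word h).
  have := hl; rewrite !block_word_cat => /and3P[hp hll hq].
  have hll' := hll; rewrite (block_step_word h) in hll'.
  have [e|hc] := block_step_cases h hll.
    rewrite !blocks_cat ?nonneg_cat ?e //; try exact: block_word_nonneg;
    by rewrite !(block_word_nonneg (n := n)).
  have [h1 h2] := hc p q; have ? := block_word_nonneg hl.
  have ? := block_word_nonneg hl'.
  by apply/eqP; rewrite eq_le !cover_le_greene.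
- by rewrite IH // (block_equiv_word hh).
- by rewrite IH1 // IH2 // -(block_equiv_word h1).
Qed.

End GreeneCover.

(** * Timed words as block words *)

Section Representation.
Variable R : realType.
Implicit Types (l p q x : seq (nat * R)) (n : nat) (w : tword R) (s t : R).

Definition positive l : bool := all (fun e => 0 < e.2) l.

Lemma positive_nonneg l : positive l -> nonneg l.
Proof. by apply: sub_all => e; exact: ltW. Qed.

Lemma letter_attained l c : positive l -> c \in letters l ->
  exists2 s, 0 <= s < weight l & blocks l s = c.
Proof.
elim: l => [|e l IH] //= /andP[he hl]; have hw := weight_ge0 (positive_nonneg hl).
rewrite weight_cons inE => /orP[/eqP ->|/(IH hl)[s hs hc]].
  by exists 0; [lra|rewrite !ifT //; lra].
exists (e.2 + s); first by lra.
by rewrite ifF; [rewrite -hc; congr (blocks _ _); ring|apply/negP; lra].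
Qed.

Lemma block_word_positive n l : positive l -> timed_word n (blocks l) ->
  block_word n l.
Proof.
move=> hl [_ h _ _ _]; rewrite /block_word positive_nonneg //=.
apply/allP => c /(letter_attained hl)[s hs <-].
by apply: h; rewrite wlen_blocks.
Qed.

Lemma weakly_increasing_pairwise l : positive l -> weakly_increasing (blocks l) ->
  pairwise leq (letters l).
Proof.
elim: l => [|e l IH] // /andP[he hl] h.
have hw := weight_ge0 (positive_nonneg hl).
have v0 : blocks (e :: l) 0 = e.1 by rewrite /= he lexx.
have vS s : 0 <= s -> blocks (e :: l) (e.2 + s) = blocks l s.
  move=> s0; rewrite /= ifF; last by apply/negP; lra.
  by congr (blocks _ _); ring.
rewrite /weakly_increasing wlen_blocks weight_cons in h.
rewrite /=; apply/andP; split.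
  apply/allP => c /(letter_attained hl)[s hs <-].
  by rewrite -v0 -vS; [apply: h; lra|lra].
apply: IH => // s t s0 st; rewrite wlen_blocks => ht.
by rewrite -!vS; [apply: h; lra|lra|lra].
Qed.

(** A locally constant function on an interval is constant; connectedness enters through the
    intermediate value theorem for the indicator of one value. *)
Lemma constant_between w (a b : R) :
  (forall t, a < t < b -> {for t, continuous w}) -> w s @[s --> a^'+] --> w a ->
  forall t, a <= t < b -> w t = w a.
Proof.
move=> hc /right_cvgP[e e0 he] t ht.
have [ta|at'] := leP t (a + e / 2).
  by have [->//|ne] := eqVneq t a; apply: he; move: ne; rewrite neq_lt => /orP[]; lra.
(* At [a] only right-continuity is known, so the argument starts from a point inside the interval
   where [w] still has the value [w a]. *)
set a' := a + e / 2 in at'; have aa' : a < a' by rewrite /a'; lra.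
have <- : w a' = w a by apply: he; rewrite /a'; lra.
pose g (s : R) : R := (w s == w a')%:R.
have cg : {in `[a', t], continuous g}.
  move=> s; rewrite in_itv /= => hs.
  have /for_continuousP[d d0 hd] : {for s, continuous w} by apply: hc; lra.
  apply/cvgrPdist_lt => r r0; exists d => //= u hu.
  have {}hu : `|u - s| < d by rewrite distrC.
  by rewrite /g (hd u hu) subrr normr0.
apply/eqP/negPn/negP => hne.
have [|||s _] := @IVT R g a' t (1 / 2).
- by lra.
- by apply: continuous_in_subspaceT => s; rewrite inE /=; exact: cg.
- by rewrite /g eqxx (negPf hne) /= minEle maxEle; do ?[case: ifPn]; lra.
- by rewrite /g; case: eqP => _ /=; lra.
Qed.

Lemma timed_word_itv_blocks n w (ds : seq R) (a : R) : timed_word n w ->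
  0 <= a < wlen w -> path <%R a ds -> all (fun d => d < wlen w) ds ->
  (forall t, a < t < wlen w -> t \notin ds -> {for t, continuous w}) ->
  exists2 l, positive l & trestrict w (a, wlen w) = blocks l.
Proof.
move=> hw; elim: ds a => [|d ds IH] a ha.
  move=> _ _ hc; exists [:: (w a, wlen w - a)]; first by rewrite /= andbT; lra.
  rewrite blocks1; apply: tword_ext => //= s; case: ifP => // hs.
  apply: (@constant_between w a (wlen w)); last by lra.
    by move=> t ht; apply: hc.
  by apply: (wval_right_continuous hw).
move=> /= /andP[ad hp] /andP[dw hd] hc.
have hds e : e \in ds -> d < e.
  by move=> he; apply: (allP (order_path_min lt_trans hp)).
have [|//|//||l hl e] := IH d; first by lra.
  move=> t ht hn; apply: hc; first by lra.
  by rewrite inE negb_or hn andbT; apply/eqP; lra.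
exists ((w a, d - a) :: l); first by rewrite /= hl andbT; lra.
rewrite blocks_cons -e; apply: tword_ext => /= [|s]; first by ring.
case: (ltP s (d - a)) => h.
  case: (leP 0 s) => h0; rewrite ?ifT //; last by lra.
  apply: (@constant_between w a d); last by lra.
    move=> t ht; apply: hc; first by lra.
    rewrite inE negb_or; apply/andP; split; first by apply/eqP; lra.
    by apply/negP => /hds; lra.
  by apply: (wval_right_continuous hw).
case: ifP => h1.
  by rewrite ifT; [congr (w _); ring|lra].
by rewrite ifF //; apply/negP; move/negP: h1; lra.
Qed.

Lemma timed_word_blocksP n w : timed_word n w ->
  exists2 l, positive l & w = blocks l.
Proof.
move=> hw; have [w0 wi wo wr wf] := hw.
have [wl|wl] := leP (wlen w) 0.
  exists [::] => //; apply: tword_ext => /= [|t]; first by lra.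
  by apply: wo; lra.
have /finite_seqP[D hD] := wf.
pose ds := sort <=%R (undup D).
have dsD d : (d \in ds) = (d \in D) by rewrite mem_sort mem_undup.
have hds d : d \in ds -> 0 < d < wlen w.
  rewrite dsD => hd; suff [] : [set t | 0 < t < wlen w /\ ~ {for t, continuous w}] d by [].
  by rewrite hD.
have [||||l hl e] := @timed_word_itv_blocks n w ds 0 hw.
- by rewrite lexx.
- rewrite path_min_sorted ?sort_lt_sorted ?undup_uniq //.
  by apply/allP => d /hds /andP[].
- by apply/allP => d /hds /andP[].
- move=> t ht; apply: contraPP => hc; apply/negP; rewrite negbK dsD.
  have : [set t | 0 < t < wlen w /\ ~ {for t, continuous w}] t by [].
  by rewrite hD.
exists l => //; rewrite -e; apply: tword_ext => /= [|t]; first by ring.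
by rewrite subr0 add0r; case: ifPn => // /wo.
Qed.

End Representation.

(** * Timed Knuth relations as moves on block words, and back *)

Section KnuthBlocks.
Variable R : realType.
Implicit Types (l p q x : seq (nat * R)) (n c : nat) (w : tword R) (s t : R).
Implicit Types (m : seq (nat * nat * R)).

Lemma positive_lower m : positive (lower m) = all (fun e => 0 < e.2) m.
Proof. by rewrite /positive all_map. Qed.

Lemma positive_upper m : positive (upper m) = all (fun e => 0 < e.2) m.
Proof. by rewrite /positive all_map. Qed.

(** The duration of the shorter leading block is cut off both lists. Each such cut uses up at least
    one block, so the total number of blocks decreases. *)
Lemma common_refinement l1 l2 : positive l1 -> positive l2 ->
  weight l1 = weight l2 ->
  exists m, [/\ all (fun e => 0 < e.2) m, blocks (lower m) = blocks l1 &
    blocks (upper m) = blocks l2].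
Proof.
have [N] := ubnP (size l1 + size l2).
elim: N l1 l2 => // N IH [|[b s] l1] [|[c t] l2] hN.
- by exists [::].
- move=> _ /andP[/= ht hl]; rewrite weight_nil weight_cons /= => hw.
  by have := weight_ge0 (positive_nonneg hl); lra.
- move=> /andP[/= ht hl] _; rewrite weight_nil weight_cons /= => hw.
  by have := weight_ge0 (positive_nonneg hl); lra.
move=> /andP[/= hs h1] /andP[/= ht h2]; rewrite !weight_cons /= => hw.
rewrite /= in hN; have [st|ts|st] := ltgtP s t.
- have [||||m [hm e1 e2]] := IH l1 ((c, t - s) :: l2).
  + by rewrite /=; lia.
  + by [].
  + by apply/andP; split=> //=; lra.
  + by rewrite weight_cons /=; lra.
  exists ((b, c, s) :: m); split; rewrite /= ?hs ?hm ?e1 //.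
  rewrite -/(upper m) e2 /= tcatA; last by rewrite /=; lra.
  rewrite tconstD; [|lra|lra].
  by have -> : s + (t - s) = t by ring.
- have [||||m [hm e1 e2]] := IH ((b, s - t) :: l1) l2.
  + by rewrite /=; lia.
  + by apply/andP; split=> //=; lra.
  + by [].
  + by rewrite weight_cons /=; lra.
  exists ((b, c, t) :: m); split; rewrite /= ?ht ?hm ?e2 //.
  rewrite -/(lower m) e1 /= tcatA; last by rewrite /=; lra.
  rewrite tconstD; [|lra|lra].
  by have -> : t + (s - t) = s by ring.
- have [||||m [hm e1 e2]] := IH l1 l2; [by lia|by []|by []|by lra|].
  exists ((b, c, t) :: m); split; rewrite /= ?ht ?hm ?e2 //.
  by rewrite -/(lower m) e1 st.
Qed.

Lemma blocks_head l : positive l -> blocks l 0 = head 0%N (letters l).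
Proof. by case: l => [|e l] //= /andP[he _]; rewrite he lexx. Qed.

Lemma last_letter_blocks l : positive l -> l != [::] ->
  last_letter (blocks l) = last 0%N (letters l).
Proof.
case/lastP: l => // l [c t] hl _; rewrite -cats1 letters_cat last_cat /=.
move: hl; rewrite -cats1 /positive all_cat /= andbT => /andP[hl ht].
have hn := positive_nonneg hl; have hw := weight_ge0 hn.
apply: (lim_left ht) => s; rewrite wlen_blocks weight_cat weight_cons weight_nil /= => hs.
rewrite blocks_cat //=; last by rewrite ltW.
by rewrite wlen_blocks ifF ?ifT //; [lra|lra|apply/negP; lra].
Qed.

Lemma letters_lt m : all (fun e => 0 < e.2) m ->
  pairwise leq (letters (lower m)) -> pairwise leq (letters (upper m)) ->
  (m = [::] \/ (last_letter (blocks (lower m)) < blocks (upper m) 0%R)%N) ->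
  allrel ltn (letters (lower m)) (letters (upper m)).
Proof.
move=> hm hl hu [->//|]; have [->//|mn] := eqVneq m [::].
rewrite last_letter_blocks ?positive_lower //; last by case: m {hm hl hu} mn.
rewrite blocks_head ?positive_upper // => hlt.
apply/allrelP => d e hd he; apply: (leq_ltn_trans _ (leq_trans hlt _)).
  move: hl hd; case/lastP: (letters (lower m)) => // s z.
  rewrite -cats1 pairwise_cat last_cat allrel1r /= => /andP[/allP h _].
  by rewrite mem_cat inE => /orP[/h|/eqP ->].
move: hu he; case: (letters (upper m)) => //= z s /andP[/allP h _].
by rewrite inE => /orP[/eqP ->|/h].
Qed.

(** The two rows of equal length in a relation are cut at common times, so that the piecewise
    exchange of matched blocks applies. *)
Lemma timed_knuth_blocks n v1 v2 : timed_knuth n v1 v2 ->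
  exists l1 l2, [/\ block_word n l1, v1 = blocks l1, v2 = blocks l2 &
    block_equiv n l1 l2].
Proof.
have matched (y z : tword R) : timed_word n y -> timed_word n z -> wlen y = wlen z ->
    exists m, [/\ all (fun e => 0 < e.2) m, y = blocks (lower m) & z = blocks (upper m)].
  move=> /timed_word_blocksP[ly hy ->] /timed_word_blocksP[lz hz ->].
  rewrite !wlen_blocks => /(common_refinement hy hz)[m [hm <- <-]].
  by exists m.
have empty_or m (y0 z0 : tword R) : y0 = blocks (lower m) -> z0 = blocks (upper m) ->
    (last_letter y0 < z0 0%R)%N ->
    (m = [::] \/ (last_letter (blocks (lower m)) < blocks (upper m) 0%R)%N).
  by move=> -> ->; right.
case=> [x y z [hx _] [hy _] [hz _] [hxyz inc] e hlt|x y z [hx _] [hy _] [hz _] [hxyz inc] e hlt].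
- have [m [hm ey ez]] := matched y z hy hz (esym e).
  have {}hlt := empty_or m y z ey ez hlt.
  have [lx px ex] := timed_word_blocksP hx.
  have pl : positive (lower m) by rewrite positive_lower.
  have pu : positive (upper m) by rewrite positive_upper.
  have nx := positive_nonneg px; have nl := positive_nonneg pl; have nu := positive_nonneg pu.
  rewrite {}ex {}ey {}ez -!blocks_cat ?nonneg_cat ?nx ?nl ?nu // in hx hy hz hxyz inc *.
  move: inc => /weakly_increasing_pairwise.
  rewrite /positive !all_cat -!/(positive _) px pl pu => /(_ isT).
  rewrite !letters_cat pairwise_cat => /and3P[_ hp1 hp2].
  have wx := block_word_positive px hx; have wl := block_word_positive pl hy.
  have wu := block_word_positive pu hz.
  exists (lx ++ upper m ++ lower m), (upper m ++ lx ++ lower m); split.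
  + by rewrite !block_word_cat wx wl wu.
  + by rewrite -catA.
  + by rewrite -catA.
  apply: block_knuth1_matched => //; apply: letters_lt => //.
  by move: hp1; rewrite pairwise_cat => /and3P[].
- have [m [hm ex ey]] := matched x y hx hy e.
  have {}hlt := empty_or m x y ex ey hlt.
  have [lz pz ez] := timed_word_blocksP hz.
  have pl : positive (lower m) by rewrite positive_lower.
  have pu : positive (upper m) by rewrite positive_upper.
  have nz := positive_nonneg pz; have nl := positive_nonneg pl; have nu := positive_nonneg pu.
  rewrite {}ex {}ey {}ez -!blocks_cat ?nonneg_cat ?nz ?nl ?nu // in hx hy hz hxyz inc *.
  move: inc => /weakly_increasing_pairwise.
  rewrite /positive !all_cat -!/(positive _) pz pl pu => /(_ isT).
  rewrite !letters_cat -catA pairwise_cat => /and3P[_ hp1 hp2].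
  have wz := block_word_positive pz hz; have wl := block_word_positive pl hx.
  have wu := block_word_positive pu hy.
  exists (upper m ++ lower m ++ lz), (upper m ++ lz ++ lower m); split.
  + by rewrite !block_word_cat wz wl wu.
  + by rewrite -catA.
  + by rewrite -catA.
  apply: block_knuth2_matched => //; apply: letters_lt => //.
  by move: hp2; rewrite pairwise_cat => /and3P[].
Qed.

Lemma timed_row_blocks n l : block_word n l -> pairwise leq (letters l) ->
  timed_row n (blocks l).
Proof.
move=> hl hp; split; first exact: timed_word_blocks.
by apply: weakly_increasing_blocks => //; exact: block_word_nonneg hl.
Qed.

Lemma last_letter_tconst c t : 0 < t -> last_letter (tconst c t) = c.
Proof.
move=> ht; rewrite -blocks1 last_letter_blocks //=.
by rewrite ht.
Qed.

Lemma tempty_blocks l : nonneg l -> (tempty R * blocks l = blocks l)%TW.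
Proof.
by move=> hl; apply: tcat0w => s hs; apply: blocks_out => //; apply/negP; lra.
Qed.

Lemma blocks_tempty l : nonneg l -> (blocks l * tempty R = blocks l)%TW.
Proof.
move=> hl; apply: tcatw0 => s; rewrite wlen_blocks => hs.
by apply: blocks_out => //; apply/negP; lra.
Qed.

Lemma block_step_knuth n l l' : block_step n l l' -> block_word n l ->
  blocks l = blocks l' \/ timed_knuth n (blocks l) (blocks l').
Proof.
case=> [c hc|c s t s0 t0|x b c t hx hbc|z a b t hz hab] hl.
- by left; rewrite blocks1 tconst0.
- left; rewrite blocks_cons !blocks1 /=; exact: tconstD.
- have : block_word n (x ++ [:: (c, t)] ++ [:: (b, t)]) by [].
  rewrite !block_word_cat => /and3P[wx wc wb].
  have nx := block_word_nonneg wx; have nc := block_word_nonneg wc.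
  have nb := block_word_nonneg wb.
  have t0 : 0 <= t by move: nb; rewrite /nonneg /= andbT.
  have eq1 : blocks (x ++ [:: (c, t); (b, t)]) = (blocks x * tconst c t * tconst b t)%TW.
    rewrite -[[:: _; _]]/([:: (c, t)] ++ [:: (b, t)]) catA.
    by rewrite !blocks_cat ?nonneg_cat ?nx ?nc ?nb // !blocks1.
  have eq2 : blocks ([:: (c, t)] ++ x ++ [:: (b, t)]) = (tconst c t * blocks x * tconst b t)%TW.
    by rewrite catA !blocks_cat ?nonneg_cat ?nx ?nc ?nb // !blocks1.
  (* At duration 0 the letters are lost and the strict inequality of the relation fails, but both
     sides are then the same word. *)
  rewrite eq1 eq2; move: t0; rewrite le_eqVlt => /predU1P[t0|t0].
    by left; rewrite -t0 !tconst0 tempty_blocks // !blocks_tempty.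
  right; apply: timed_knuth1 => //.
  + by apply: timed_row_blocks => //; move: hx; rewrite pairwise_cat => /and3P[].
  + by rewrite -blocks1; apply: timed_row_blocks.
  + by rewrite -blocks1; apply: timed_row_blocks.
  + rewrite -(blocks1 b) -(blocks1 c) -!blocks_cat ?nonneg_cat ?nx ?nc ?nb //.
    apply: timed_row_blocks; first by rewrite !block_word_cat wx wb.
    rewrite !letters_cat pairwise_cat hx allrel1r /= andbT all_cat /= (ltnW hbc) andbT.
    apply/andP; split=> //; move: hx; rewrite pairwise_cat allrel1r => /and3P[/allP h _ _].
    by apply/allP => d /h /= hd; exact: leq_trans hd (ltnW hbc).
  + by rewrite last_letter_tconst //= lexx t0.
- have : block_word n ([:: (b, t)] ++ [:: (a, t)] ++ z) by [].
  rewrite !block_word_cat => /and3P[wb wa wz].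
  have nz := block_word_nonneg wz; have na := block_word_nonneg wa.
  have nb := block_word_nonneg wb.
  have t0 : 0 <= t by move: nb; rewrite /nonneg /= andbT.
  have eq1 : blocks ([:: (b, t); (a, t)] ++ z) = (tconst b t * tconst a t * blocks z)%TW.
    rewrite -[[:: _; _]]/([:: (b, t)] ++ [:: (a, t)]).
    by rewrite !blocks_cat ?nonneg_cat ?nz ?na ?nb // !blocks1.
  have eq2 : blocks ([:: (b, t)] ++ z ++ [:: (a, t)]) = (tconst b t * blocks z * tconst a t)%TW.
    by rewrite catA !blocks_cat ?nonneg_cat ?nz ?na ?nb // !blocks1.
  rewrite eq1 eq2; move: t0; rewrite le_eqVlt => /predU1P[t0|t0].
    by left; rewrite -t0 !tconst0 tcat0w // tempty_blocks // blocks_tempty.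
  have hab' := ltnW hab.
  have /andP[/allP hbz pz] : pairwise leq (b :: letters z) := hz.
  right; apply: timed_knuth2 => //.
  + by rewrite -blocks1; apply: timed_row_blocks.
  + by rewrite -blocks1; apply: timed_row_blocks.
  + exact: timed_row_blocks.
  + rewrite -(blocks1 b) -(blocks1 a) -!blocks_cat ?nonneg_cat ?nz ?na ?nb //.
    apply: timed_row_blocks; first by rewrite !block_word_cat wa wb.
    rewrite -catA; apply/andP; split; last exact: hz.
    rewrite /= hab'; apply/allP => d /hbz hd; exact: leq_trans hab' hd.
  + by rewrite last_letter_tconst //= lexx t0.
Qed.

Lemma block_equiv_knuth n l l' : block_equiv n l l' -> block_word n l ->
  knuth_equivalent n (blocks l) (blocks l').
Proof.
elim=> {l l'} [p q l l' h|l|l l' hh IH|l' l l'' h1 IH1 h2 IH2] hl.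
- have := hl; rewrite !block_word_cat => /and3P[hp hll hq].
  have hll' := hll; rewrite (block_step_word h) in hll'.
  have np := block_word_nonneg hp; have nq := block_word_nonneg hq.
  have nl := block_word_nonneg hll; have nl' := block_word_nonneg hll'.
  rewrite !catA !blocks_cat ?nonneg_cat ?np ?nl ?nl' ?nq //.
  have [->|hk] := block_step_knuth h hll; first exact: rst_refl.
  by apply/rst_step/KnuthStep => //; exact: timed_word_blocks.
- exact: rst_refl.
- by apply/rst_sym/IH; rewrite (block_equiv_word hh).
- apply: (rst_trans _ _ _ (blocks l')); first exact: IH1.
  by apply: IH2; rewrite -(block_equiv_word h1).
Qed.

Lemma knuth_greene n w w' u v k : timed_word n u -> timed_word n v ->
  knuth_equivalent n w w' ->
  greene k (u * w * v)%TW = greene k (u * w' * v)%TW.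
Proof.
move=> hu hv; have [lu pu eu] := timed_word_blocksP hu.
have [lv pv ev] := timed_word_blocksP hv; rewrite {}eu {}ev in hu hv *.
have nu := positive_nonneg pu; have nv := positive_nonneg pv.
elim=> {w w'} [w w' [p q v1 v2 hp hq hk]|//|w w' _ -> //|w1 w2 w3 _ -> _ -> //].
have [l1 [l2 [hl1 -> -> h]]] := timed_knuth_blocks hk.
have hl2 := hl1; rewrite (block_equiv_word h) in hl2.
have [lp pp ep] := timed_word_blocksP hp; have [lq pq eq] := timed_word_blocksP hq.
rewrite ep in hp *; rewrite eq in hq *.
have wu := block_word_positive pu hu; have wv := block_word_positive pv hv.
have wp := block_word_positive pp hp; have wq := block_word_positive pq hq.
have np := positive_nonneg pp; have nq := positive_nonneg pq.
have n1 := block_word_nonneg hl1; have n2 := block_word_nonneg hl2.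
have := @block_equiv_greene R n k (lu ++ (lp ++ l1 ++ lq) ++ lv) (lu ++ (lp ++ l2 ++ lq) ++ lv).
rewrite -!blocks_cat ?nonneg_cat ?nu ?nv ?np ?nq ?n1 ?n2 // -!catA; apply.
  have := block_equiv_ctx (lu ++ lp) (lq ++ lv) h.
  by rewrite -!catA.
by rewrite !block_word_cat wu wv wp wq hl1.
Qed.

End KnuthBlocks.

(** * Greene invariants of tableaux *)

Section TableauGreene.
Variables (R : realType) (n : nat).
Implicit Types (r : nat -> R) (T : seq (nat -> R)) (cl : seq (nat * R * nat)).
Implicit Types (i j k m c d : nat).

Local Notation row_at T i := (nth (@zero_row R) T i).

(** Each block of the reading word remembers its row, so that a set of blocks can also be weighed in
    a tableau with modified rows. *)
Fixpoint cells T : seq ((nat -> R) * nat) :=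
  if T is r :: T' then cells T' ++ [seq (r, c) | c <- iota 1 n] else [::].

Lemma readingE T : reading n T = [seq (p.2, mult p.1 p.2) | p <- cells T].
Proof.
by elim: T => [|r T IH] //=; rewrite IH map_cat -map_comp.
Qed.

Lemma lift_colours (A B : Type) (f : A -> B) (s : seq A) (cs : seq (B * nat)) :
  map fst cs = map f s ->
  exists2 kc : seq (A * nat), map fst kc = s & cs = [seq (f e.1, e.2) | e <- kc].
Proof.
elim: cs s => [|[b j] cs IH] [|a s] //=; first by exists [::].
by move=> [-> /IH[kc <- ->]]; exists ((a, j) :: kc).
Qed.

(** Distinct letters beyond [d] occupy disjoint stretches of the row to the right of [r d]. *)
Lemma path_mult r (x : R) d (q : seq nat) : is_row r -> x <= r d -> path ltn d q ->
  x + \sum_(c <- q) mult r c <= r (last d q).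
Proof.
move=> hr; elim: q d x => [|c q IH] d x hx /=; first by rewrite big_nil addr0.
move=> /andP[dc hq]; rewrite big_cons addrA; apply: IH => //.
have : r d <= r c.-1 by apply: row_mono => //; lia.
by rewrite /mult; lra.
Qed.

(* In each row the chain continues to the right of the cells covered so far in
   the rows below it, as the row of cumulative lengths bounds them from above. *)
Lemma chain_weight T (b : bitseq) : tableau T -> size b = size (cells T) ->
  pairwise leq [seq p.2 | p <- mask b (cells T)] ->
  \sum_(p <- mask b (cells T)) mult p.1 p.2 <=
  head (@zero_row R) T (last 0%N [seq p.2 | p <- mask b (cells T)]).
Proof.
elim: T b => [|r T IH] b /=.
  by move=> _ /size0nil -> _; rewrite big_nil.
move=> [hr hd hT]; rewrite size_cat => hb.
rewrite -(cat_take_drop (size (cells T)) b) mask_cat; last first.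
  by rewrite size_takel // hb leq_addr.
set s1 := mask _ (cells T); set q := mask (drop (size (cells T)) b) (iota 1 n).
have -> : mask (drop (size (cells T)) b) [seq (r, c) | c <- iota 1 n] = [seq (r, c) | c <- q].
  by rewrite map_mask.
rewrite big_cat map_cat -map_comp map_id pairwise_cat last_cat => /and3P[h12 h1 _].
rewrite big_map /=.
(* By column strictness, the columns available in the lower rows up to a given last letter lie under
   strictly smaller letters of [r], whence the predecessor. *)
have {}IH : \sum_(p <- s1) mult p.1 p.2 <= r (last 0%N [seq p.2 | p <- s1]).-1.
  apply: (le_trans (IH _ hT _ h1)); first by rewrite size_takel // hb leq_addr.
  case: (last _ _) => [|d] /=; last exact: hd.
  by rewrite (proj1 (is_row_head hT)) (proj1 hr).
have hq : pairwise ltn q.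
  by apply: pairwise_mask; rewrite -(sorted_pairwise ltn_trans) iota_ltn_sorted.
have h1q : all (leq (last 0%N [seq p.2 | p <- s1])) q.
  move: h12; case/lastP: [seq p.2 | p <- s1] => [|s d] h.
    by apply/allP.
  by rewrite last_rcons; move: h; rewrite -cats1 allrel_catl allrel1l => /andP[].
move: IH hq h1q {h12}; set d := last 0%N _; set x := \sum_(p <- s1) _.
case: q => [|c q] /= hx; first by rewrite big_nil addr0 => _ _; apply: (le_trans hx);
  apply: row_mono => //; exact: leq_pred.
move=> /andP[hc hq] /andP[dc _]; rewrite big_cons addrA.
apply: path_mult => //; last by rewrite (path_pairwise ltn_trans) /= hc.
have : r d.-1 <= r c.-1 by apply: row_mono => //; lia.
by rewrite /mult; lra.
Qed.

(** The part of a row in the columns up to [L]; cutting all rows at the same [L] preserves column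
    strictness. *)
Definition truncate (L : R) r : nat -> R := fun c => Num.min (r c) L.

Lemma is_row_truncate L r : 0 <= L -> is_row r -> is_row (truncate L r).
Proof.
move=> L0 [r0 hr]; split; first by rewrite /truncate r0 minEle L0.
by move=> c; rewrite /truncate !minEle; have := hr c; do ?[case: ifPn]; lra.
Qed.

Lemma tableau_truncate L T : 0 <= L -> tableau T -> tableau (map (truncate L) T).
Proof.
move=> L0; elim: T => [|r T IH] //= [hr hd hT]; split.
- exact: is_row_truncate.
- case: T hd {IH hT} => [|r' T] hd c /=.
    by apply: row_ge0; exact: is_row_truncate.
  by rewrite /truncate !minEle; have := hd c; rewrite /=; do ?[case: ifPn]; lra.
- exact: IH.
Qed.

Lemma row_at_decr T i m : tableau T -> row_at T i.+1 m <= row_at T i m.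
Proof.
elim: T i => [|r T IH] i; first by rewrite !nth_nil.
move=> [hr hd hT]; case: i => [|i]; last exact: IH.
have hh : row_at T 0 = head (@zero_row R) T by case: (T).
rewrite /= hh; apply: le_trans (hd m).
by apply: (proj2 (is_row_head hT)).
Qed.

Lemma row_at_ge0 T i m : tableau T -> 0 <= row_at T i m.
Proof.
elim: T i => [|r T IH] i; first by rewrite nth_nil.
by move=> [hr hd hT]; case: i => [|i]; [exact: row_ge0|exact: IH].
Qed.

Lemma row_at_mono T i j m : tableau T -> (i <= j)%N -> row_at T j m <= row_at T i m.
Proof.
move=> hT /subnK <-; elim: (j - i)%N => [|e IH] //.
exact: le_trans (row_at_decr _ _ hT) IH.
Qed.

(** Row lengths at [m] decrease down the tableau, so rows after row [k] do not reach beyond the cut,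
    and row [k] ends exactly there. *)
Lemma excess_sum T k m : tableau T ->
  \sum_(r <- T) (r m - truncate (row_at T k m) r m) =
  \sum_(i < k.+1) (row_at T i m - row_at T k m).
Proof.
elim: T k => [|r T IH] k.
  move=> _; rewrite big_nil big1 // => i _; rewrite !nth_nil; exact: subrr.
move=> hT; rewrite big_cons; have := hT => -[hr hd hT'].
case: k => [|k].
  rewrite big_ord1 /= subrr /truncate minEle lexx subrr add0r.
  rewrite (big_nth (@zero_row R)) big1_seq // => i _.
  have := row_at_mono m hT (leq0n i.+1) => /= h.
  by rewrite minEle h subrr.
rewrite big_ord_recl /= -(IH k hT'); congr (_ + _).
have /= h := row_at_mono m hT (leq0n k.+1).
by rewrite /truncate minEle; case: ifPn; lra.
Qed.

Lemma sum_mult_le r m : is_row r -> (m <= n)%N ->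
  \sum_(c <- iota 1 n | (c <= m)%N) mult r c = r m.
Proof.
move=> hr mn; rewrite -{1}(subnKC mn) iotaD big_cat /=.
rewrite [X in _ + X]big1_seq; last first.
  by move=> c /andP[h]; rewrite mem_iota; lia.
rewrite addr0 -[RHS]subr0 -{2}(proj1 hr) -{1}[m in iota _ m]subn0 -sum_mult //.
rewrite big_seq_cond [RHS]big_seq; apply: eq_bigl => c.
by rewrite mem_iota; lia.
Qed.

Lemma excess_cells L T m : 0 <= L -> tableau T -> (m <= n)%N ->
  \sum_(p <- cells T | (p.2 <= m)%N) (mult p.1 p.2 - mult (truncate L p.1) p.2) =
  \sum_(r <- T) (r m - truncate L r m).
Proof.
move=> L0 + mn; elim: T => [|r T IH] /=; first by rewrite !big_nil.
move=> [hr _ hT]; rewrite big_cat IH // big_map big_cons addrC; congr (_ + _).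
by rewrite /= sumrB !sum_mult_le //; exact: is_row_truncate.
Qed.

Lemma excess_ge0 L T : 0 <= L -> tableau T ->
  all (fun p => 0 <= mult p.1 p.2 - mult (truncate L p.1) p.2) (cells T).
Proof.
move=> L0; elim: T => [|r T IH] //= [hr _ hT]; rewrite all_cat IH //= all_map.
apply/allP => c _ /=; rewrite /mult /truncate !minEle.
by have := row_mono hr (leq_pred c); do ?[case: ifPn]; lra.
Qed.

Lemma sum_sub (A : Type) (s : seq A) (P Q : pred A) (y : A -> R) :
  all (fun e => P e ==> Q e) s -> all (fun e => 0 <= y e) s ->
  \sum_(e <- s | P e) y e <= \sum_(e <- s | Q e) y e.
Proof.
elim: s => [|e s IH] /=; first by rewrite !big_nil.
move=> /andP[hPQ h1] /andP[hy h2]; rewrite !big_cons; have {}IH := IH h1 h2.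
by case: (P e) hPQ => /= [->|_]; [lra|case: (Q e); lra].
Qed.

Lemma all_colours (A : Type) (s : seq (A * nat)) (Q : pred (A * nat)) k :
  (forall i, (i < k)%N -> all (fun e => (e.2 == i) ==> Q e) s) ->
  all (fun e => (e.2 < k)%N ==> Q e) s.
Proof.
elim: s => [|e s IH] //= H; apply/andP; split.
  by apply/implyP => he; have /andP[] := H _ he; rewrite eqxx.
by apply: IH => i /H /andP[].
Qed.

Lemma sum_colours (A : Type) (s : seq (A * nat)) (g : A * nat -> R) k :
  \sum_(e <- s | (e.2 < k)%N) g e = \sum_(i < k) \sum_(e <- s | e.2 == i) g e.
Proof.
elim: s => [|e s IH]; first by rewrite big_nil big1 // => i _; rewrite big_nil.
rewrite big_cons IH.
have E (i : 'I_k) : \sum_(e0 <- e :: s | e0.2 == i) g e0 =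
    (if e.2 == i then g e else 0) + \sum_(e0 <- s | e0.2 == i) g e0.
  by rewrite big_cons; case: ifP => // _; rewrite add0r.
under [RHS]eq_bigr => i _ do rewrite E.
rewrite big_split /=; case: ltnP => h; last first.
  rewrite [X in _ = X + _]big1 ?add0r // => i _.
  by case: eqP => // hi; move: (ltn_ord i); rewrite -hi ltnNge h.
congr (_ + _); rewrite (bigD1 (Ordinal h)) //= eqxx big1 ?addr0 // => i hi.
by rewrite ifN //; apply: contra hi => /eqP hi; apply/eqP/val_inj; rewrite /= hi.
Qed.

(** Each block is split at column [L], the length at [m] of the last of the k rows. A chain weighs
    at most [L] in the truncated tableau, whose first row is no longer than that; the parts of all
    letters <= m beyond [L] add up to the excesses of the k rows over [L]. The k copies of [L] then
    complete the sum. *)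
Lemma tableau_cover T k m cl : tableau T -> (0 < k)%N -> (m <= n)%N ->
  [seq e.1 | e <- cl] = reading n T -> colouring leq k cl ->
  (forall i, (i < k)%N -> all (leq^~ m) (chain i cl)) ->
  covered k cl <= \sum_(i < k) row_at T i m.
Proof.
move=> hT k0 mn hcl hk hm.
have [kc hkc ecl] : exists2 kc : seq (((nat -> R) * nat) * nat), map fst kc = cells T &
    cl = [seq ((e.1.2, mult e.1.1 e.1.2), e.2) | e <- kc].
  by apply: (lift_colours (f := fun p => (p.2, mult p.1 p.2))); rewrite -readingE.
have chainE i : chain i cl = [seq e.1.2 | e <- kc & e.2 == i].
  by rewrite ecl /chain filter_map -map_comp.
case: k k0 hk hm => // k _ hk hm.
pose L := row_at T k m.
have L0 : 0 <= L by exact: row_at_ge0.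
have -> : covered k.+1 cl = \sum_(e <- kc | (e.2 < k.+1)%N) mult e.1.1 e.1.2.
  by rewrite ecl /covered big_map.
rewrite (eq_bigr (fun e => mult (truncate L e.1.1) e.1.2 +
  (mult e.1.1 e.1.2 - mult (truncate L e.1.1) e.1.2))); last by move=> e _; ring.
rewrite big_split /=.
have h1 : \sum_(e <- kc | (e.2 < k.+1)%N) mult (truncate L e.1.1) e.1.2 <= \sum_(i < k.+1) L.
  rewrite sum_colours; apply: ler_sum => i _.
  pose b := [seq e.2 == i :> nat | e <- kc].
  have cellsE : cells (map (truncate L) T) = [seq (truncate L p.1, p.2) | p <- cells T].
    by elim: (T) => [|r T' IH] //=; rewrite IH map_cat -!map_comp.
  have maskE : mask b (cells (map (truncate L) T)) =
      [seq (truncate L e.1.1, e.1.2) | e <- kc & e.2 == i :> nat].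
    by rewrite cellsE -hkc -!map_comp -map_mask -filter_mask.
  have sz : size b = size (cells (map (truncate L) T)).
    by rewrite cellsE -hkc !size_map.
  have := chain_weight (tableau_truncate L0 hT) sz.
  rewrite maskE big_map big_filter -map_comp /= -chainE => /(_ (hk i (ltn_ord i))).
  move=> /le_trans; apply; case: (T) => [|r T'] //=.
  by rewrite /truncate ge_min lexx orbT.
have h2 : \sum_(e <- kc | (e.2 < k.+1)%N) (mult e.1.1 e.1.2 - mult (truncate L e.1.1) e.1.2)
    <= \sum_(i < k.+1) (row_at T i m - L).
  rewrite -excess_sum // -(excess_cells L0 hT mn) -hkc big_map.
  apply: sum_sub.
    apply: all_colours => i hi; have := hm i hi.
    by rewrite chainE all_map all_filter.
  by have := excess_ge0 L0 hT; rewrite -hkc all_map.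
apply: (le_trans (lerD h1 h2)); rewrite -big_split /=.
by apply: ler_sum => i _; lra.
Qed.

End TableauGreene.

(** * Staircase words separate tableaux *)

Section Staircase.
Variables (R : realType) (n : nat).
Implicit Types (r : nat -> R) (T : seq (nat -> R)) (cl : seq (nat * R * nat)).
Implicit Types (i j k m c d : nat) (M : R).

Local Notation row_at T i := (nth (@zero_row R) T i).

Definition staircase m k M : seq (nat * R) := [seq ((m - j)%N, M) | j <- iota 0 k].

Lemma letters_staircase m k M : letters (staircase m k M) = [seq (m - j)%N | j <- iota 0 k].
Proof. by rewrite /letters -map_comp. Qed.

Lemma block_word_staircase m k M : (k <= m <= n)%N -> 0 <= M ->
  block_word n (staircase m k M).
Proof.
move=> hk M0; rewrite /block_word letters_staircase /nonneg !all_map.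
by apply/andP; split; apply/allP => j //=; rewrite mem_iota; lia.
Qed.

Lemma block_word_reading T : tableau T -> block_word n (reading n T).
Proof.
elim: T => [|r T IH] //= [hr _ /IH hT]; rewrite block_word_cat hT /=.
rewrite /block_word letters_fblocks /nonneg all_map; apply/andP; split.
  by apply/allP => c _; exact: mult_ge0.
by apply/allP => c; rewrite mem_iota; lia.
Qed.

Lemma staircase_decr m k M : (k <= m)%N -> pairwise gtn (letters (staircase m k M)).
Proof.
move=> km; rewrite letters_staircase pairwise_map.
have := iota_ltn_sorted 0 k; rewrite (sorted_pairwise ltn_trans).
apply: (@sub_in_pairwise _ (mem (iota 0 k)) ltn); last by apply/allP.
by move=> i j; rewrite !mem_iota /=; lia.
Qed.

Lemma decreasing_uniq k cl : pairwise gtn (letters [seq e.1 | e <- cl]) ->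
  colouring leq k cl -> uniq [seq e.2 | e <- cl & (e.2 < k)%N].
Proof.
elim: cl => [|e cl IH] //= /andP[/allP hd hp] hk.
have hk' : colouring leq k cl.
  by move=> i /hk; rewrite chain_cons pairwise_cat => /and3P[].
case: ifP => he; last exact: IH.
rewrite /= IH // andbT; apply/negP => /mapP[f]; rewrite mem_filter => /andP[_ hf] ef.
have := hk _ he; rewrite chain_cons eqxx pairwise_cat allrel1l => /and3P[/allP h _ _].
have hfc : f.1.1 \in chain e.2 cl by apply/mapP; exists f; rewrite ?mem_filter ?ef ?eqxx.
have hfl : f.1.1 \in letters [seq e.1 | e <- cl] by do 2 apply: map_f.
by have := h _ hfc; have := hd _ hfl; rewrite /= ltnNge => /negPf ->.
Qed.

Lemma covered_staircase k m M cl : [seq e.1 | e <- cl] = staircase m k M ->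
  covered k cl = M * (size [seq e.2 | e <- cl & (e.2 < k)%N])%:R.
Proof.
move=> hcl; have : all (fun e => e.1.2 == M) cl.
  have : all (fun e => e.2 == M) [seq e.1 | e <- cl] by rewrite hcl all_map; apply/allP => j _ /=.
  by rewrite all_map.
elim: cl {hcl} => [|e cl IH] /=; first by rewrite covered_nil mulr0.
move=> /andP[/eqP he /IH h]; rewrite covered_cons h he; case: ifP => _ /=.
  by rewrite -natr1; ring.
by rewrite add0r.
Qed.

Lemma staircase_upper T k m M cl : tableau T -> (0 < k <= m)%N -> (m <= n)%N ->
  weight (reading n T) <= M -> [seq e.1 | e <- cl] = reading n T ++ staircase m k M ->
  colouring leq k cl ->
  covered k cl <= \sum_(i < k) row_at T i m + M * k%:R.
Proof.
move=> hT /andP[k0 km] mn hM /map_eq_cat[c1 [c2 [-> h1 h2]]] hk.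
have M0 : 0 <= M.
  apply: le_trans hM; apply: weight_ge0; exact: block_word_nonneg (block_word_reading hT).
have hk1 : colouring leq k c1.
  by move=> i /hk; rewrite chain_cat pairwise_cat => /and3P[].
have hk2 : colouring leq k c2.
  by move=> i /hk; rewrite chain_cat pairwise_cat => /and3P[].
rewrite covered_cat (covered_staircase h2).
set cols := [seq e.2 | e <- c2 & _].
have ucols : uniq cols by apply: decreasing_uniq => //; rewrite h2 staircase_decr.
have cols_k : {subset cols <= iota 0 k}.
  by move=> i /mapP[e]; rewrite mem_filter mem_iota => /andP[he _] ->.
have scols : (size cols <= k)%N by rewrite -[k in (_ <= k)%N](size_iota 0); exact: uniq_leq_size.
(* If every colour occurs in the staircase, each chain has a letter <= m there, so all its letters
   in [T] are <= m. *)
have [hall|] := boolP (all (fun i => i \in cols) (iota 0 k)).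
  apply: lerD; last by apply: ler_wpM2l => //; rewrite ler_nat.
  apply: (@tableau_cover R n) => // i hi.
  have : i \in cols by apply: (allP hall); rewrite mem_iota.
  move=> /mapP[e]; rewrite mem_filter => /andP[_ he] ei.
  have := hk i hi; rewrite chain_cat pairwise_cat => /and3P[/allrelP h _ _].
  apply/allP => c hc; apply: (leq_trans (h c e.1.1 hc _)).
    by apply/mapP; exists e; rewrite ?mem_filter ?ei ?eqxx.
  have : e.1.1 \in letters [seq e.1 | e <- c2] by do 2 apply: map_f.
  by rewrite h2 letters_staircase => /mapP[j _ ->]; exact: leq_subr.
move=> /allPn[i hi hin].
(* A colour missing from the staircase loses a full [M], no less than the weight of all of [T]. *)
have s1 : (size cols < k)%N.
  have : (size cols <= size (rem i (iota 0 k)))%N.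
    apply: uniq_leq_size => // j hj; rewrite mem_rem_uniq ?iota_uniq // inE cols_k // andbT.
    by apply: contra hin => /eqP <-.
  by rewrite size_rem // size_iota; lia.
have hc1 : covered k c1 <= M.
  apply: le_trans hM; rewrite -h1; apply: covered_le_weight.
  by rewrite h1; exact: block_word_nonneg (block_word_reading hT).
have hs : M + M * (size cols)%:R <= M * k%:R.
  have -> : M + M * (size cols)%:R = M * (size cols).+1%:R by rewrite -natr1; ring.
  by apply: ler_wpM2l => //; rewrite ler_nat.
have hsum : 0 <= \sum_(j < k) row_at T j m by apply: sumr_ge0 => j _; exact: row_at_ge0.
lra.
Qed.

(* Row i (counted from 0) contributes its letters c <= m to chain
   max i (c - (m - k) - 1), so that chain j ends with the letter
   m - k + 1 + j of row 0 and goes on with the same letter of the staircase. *)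
Definition tableau_colour k m i c : nat :=
  if (i < k)%N && (c <= m)%N then maxn i (c - (m - k).+1) else k.

Fixpoint colour_reading k m i T : seq (nat * R * nat) :=
  if T is r :: T' then
    colour_reading k m i.+1 T' ++
    [seq ((c, mult r c), tableau_colour k m i c) | c <- iota 1 n]
  else [::].

Lemma colour_reading_fst k m i T : [seq e.1 | e <- colour_reading k m i T] = reading n T.
Proof. by elim: T i => [|r T IH] i //=; rewrite map_cat IH -map_comp. Qed.

Lemma tableau_colourP k m i c j : (k <= m)%N -> (j < k)%N ->
  tableau_colour k m i c = j ->
  [/\ (i <= j)%N, (c <= (m - k).+1 + j)%N & (i < j)%N -> c = ((m - k).+1 + j)%N].
Proof.
by move=> km jk; rewrite /tableau_colour; case: ifP => [/andP[]|]; split; lia.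
Qed.

(** Chain [j] takes from row [j] the letters up to m - k + 1 + j, and from the rows above it that
    letter alone. The last clause, that rows below row [j] give nothing, is what the induction on
    rows uses when the chain starts. *)
Lemma colour_reading_chain k m i j T : (k <= m)%N -> (j < k)%N ->
  [/\ all (leq^~ ((m - k).+1 + j)%N) (chain j (colour_reading k m i T)),
      pairwise leq (chain j (colour_reading k m i T)) &
      (j < i)%N -> chain j (colour_reading k m i T) = [::]].
Proof.
move=> km jk; elim: T i => [|r T IH] i /=; first by [].
have [h1 h2 h3] := IH i.+1; rewrite chain_cat.
have -> : chain j [seq ((c, mult r c), tableau_colour k m i c) | c <- iota 1 n] =
    [seq c <- iota 1 n | tableau_colour k m i c == j].
  by rewrite /chain filter_map -map_comp map_id.
set B := [seq c <- _ | _].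
have hB c : c \in B -> [/\ (i <= j)%N, (c <= (m - k).+1 + j)%N &
    (i < j)%N -> c = ((m - k).+1 + j)%N].
  by rewrite mem_filter => /andP[/eqP h _]; exact: tableau_colourP h.
have Ble : all (leq^~ ((m - k).+1 + j)%N) B by apply/allP => c /hB[].
have Bp : pairwise leq B.
  by apply: pairwise_filter; rewrite -(sorted_pairwise leq_trans) iota_sorted.
split.
- by rewrite all_cat h1.
- rewrite pairwise_cat h2 Bp !andbT; apply/allrelP => c d hc hd.
  have [hij|hji] := ltnP i j.
    by have [_ _ /(_ hij) ->] := hB d hd; exact: (allP h1).
  by move: hc; rewrite h3.
- move=> ji; rewrite h3 ?(ltnW ji) //; last by lia.
  by case: B hB {Ble Bp} => // c B /(_ c (mem_head _ _))[]; lia.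
Qed.

Lemma colour_reading_covered k m i T : tableau T -> (k <= m)%N -> (m <= n)%N ->
  covered k (colour_reading k m i T) = \sum_(j < k - i) row_at T j m.
Proof.
move=> hT km mn; elim: T i hT => [|r T IH] i.
  by move=> _; rewrite covered_nil big1 // => j _; rewrite nth_nil.
move=> [hr _ hT]; rewrite /= covered_cat IH //.
have colk c : (tableau_colour k m i c < k)%N = (i < k)%N && (c <= m)%N.
  by rewrite /tableau_colour; case: ifP => [/andP[]|]; lia.
rewrite /covered big_map (eq_bigl (fun c => (i < k)%N && (c <= m)%N)); last exact: colk.
have [ik|ki] := ltnP i k; last first.
  rewrite [X in _ + X]big_pred0 // addr0.
  have -> : (k - i.+1 = 0)%N by lia.
  have -> : (k - i = 0)%N by lia.
  by rewrite !big_ord0.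
rewrite /= sum_mult_le // (_ : (k - i = (k - i.+1).+1)%N); last by lia.
by rewrite big_ord_recl addrC.
Qed.

Lemma staircase_lower T k m M : tableau T -> (k <= m)%N -> (m <= n)%N -> 0 <= M ->
  exists cl, [/\ [seq e.1 | e <- cl] = reading n T ++ staircase m k M,
    colouring leq k cl & covered k cl = \sum_(i < k) row_at T i m + M * k%:R].
Proof.
move=> hT km mn M0.
(* The staircase letter m - j equals m - k + 1 + (k - 1 - j), the largest letter allowed on chain k
   - 1 - j. *)
exists (colour_reading k m 0 T ++ [seq ((m - j)%N, M, (k.-1 - j)%N) | j <- iota 0 k]).
split.
- by rewrite map_cat colour_reading_fst -map_comp.
- move=> j jk; rewrite chain_cat; have [h1 h2 _] := colour_reading_chain 0 T km jk.
  set B := chain j (map _ (iota 0 k)).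
  have hB c : c \in B -> c = ((m - k).+1 + j)%N.
    rewrite /B /chain filter_map -map_comp => /mapP[d].
    by rewrite mem_filter mem_iota /= => /andP[/eqP hd hdk] ->; lia.
  rewrite pairwise_cat h2; apply/and3P; split=> //.
    by apply/allrelP => c d hc /hB ->; exact: (allP h1).
  elim: B hB => //= c B IH hB; rewrite IH ?andbT.
    apply/allP => d hd; rewrite (hB c) ?mem_head // (hB d) //.
    by rewrite inE hd orbT.
  by move=> d hd; apply: hB; rewrite inE hd orbT.
- rewrite covered_cat colour_reading_covered // subn0; congr (_ + _).
  rewrite /covered big_map big_mkcond /= big_seq (eq_bigr (fun=> M)); last first.
    by move=> j; rewrite mem_iota => hj; rewrite ifT //; lia.
  by rewrite -big_seq big_const_seq count_predT size_iota -Monoid.iteropE mulr_natr.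
Qed.

Lemma greene_staircase T k m M : tableau T -> (0 < k <= m)%N -> (m <= n)%N ->
  weight (reading n T) <= M ->
  greene k (blocks (reading n T ++ staircase m k M)) =
  \sum_(i < k) row_at T i m + M * k%:R.
Proof.
move=> hT hkm mn hM; have /andP[k0 km] := hkm.
have nT := block_word_nonneg (block_word_reading hT).
have M0 : 0 <= M by apply: le_trans hM; exact: weight_ge0.
have hl : nonneg (reading n T ++ staircase m k M).
  rewrite nonneg_cat nT; apply: (@block_word_nonneg _ n).
  by rewrite block_word_staircase // km.
apply/eqP; rewrite eq_le; apply/andP; split.
  by apply: greene_le => // cl; exact: staircase_upper.
have [cl [h1 h2 <-]] := staircase_lower hT km mn M0.
by rewrite -h1; apply: greene_ge; rewrite ?h1.
Qed.

Lemma row_at_strict T i m : tableau T -> row_at T i.+1 m.+1 <= row_at T i m.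
Proof.
elim: T i => [|r T IH] i; first by rewrite !nth_nil.
move=> [hr hd hT]; case: i => [|i]; last exact: IH.
by have := hd m; case: (T).
Qed.

(** By column strictness row [i], counted from 0, has no letter below i + 1. Hence staircases with k
    <= m see every nonzero row length. *)
Lemma row_at_zero T i m : tableau T -> (m <= i)%N -> row_at T i m = 0.
Proof.
move=> hT; elim: m i => [|m IH] i hi.
  elim: T i hT {hi} => [|r T IH] i; first by rewrite nth_nil.
  by move=> [[r0 _] _ hT]; case: i => [|i] //=; exact: IH.
case: i hi => // i hi; apply/eqP; rewrite eq_le row_at_ge0 // andbT.
by rewrite -(IH i) //; exact: row_at_strict.
Qed.

Lemma eq_row_sums T T' i m : tableau T -> tableau T' ->
  (forall k, (0 < k <= m)%N ->
     \sum_(j < k) row_at T j m = \sum_(j < k) row_at T' j m) ->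
  row_at T i m = row_at T' i m.
Proof.
move=> hT hT' H; have [mi|im] := leqP m i; first by rewrite !row_at_zero.
have := H i.+1 im; rewrite !big_ord_recr /=.
have -> : \sum_(j < i) row_at T j m = \sum_(j < i) row_at T' j m.
  case: i im => [|i] im; first by rewrite !big_ord0.
  by apply: H; rewrite /= ltnW.
by move/addrI.
Qed.

Lemma row_blocks_zero r : (forall m, (m <= n)%N -> r m = 0) ->
  block_equiv n (row_blocks n r) [::].
Proof.
move=> h; apply: fblocks_zero => c; rewrite mem_iota => hc; first lia.
by rewrite /mult !h ?subrr //; lia.
Qed.

(** The lists need not be equal: one tableau may have additional rows of length 0, whose zero blocks
    vanish only up to [block_equiv]. *)
Lemma reading_equiv T T' :
  (forall i m, (m <= n)%N -> row_at T i m = row_at T' i m) ->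
  block_equiv n (reading n T) (reading n T').
Proof.
have zero S : (forall i m, (m <= n)%N -> row_at S i m = 0) ->
    block_equiv n (reading n S) [::].
  elim: S => [|r S IH] h; first exact: block_equiv_refl.
  have h0 := row_blocks_zero (h 0%N).
  exact: (block_equiv_cat (IH (fun i => h i.+1)) h0).
elim: T T' => [|r T IH] T' h.
  by apply/block_equiv_sym/zero => i m /h <-; rewrite nth_nil.
case: T' h => [|r' T'] h.
  by apply: zero => i m /h ->; rewrite nth_nil.
rewrite /= (eq_row_blocks (h 0%N)).
apply: block_equiv_cat; last exact: block_equiv_refl.
by apply: IH => i; exact: h i.+1.
Qed.

End Staircase.

Theorem theorem4p4 (R : realType) (n : nat) (w w' : tword R)
    (hw : timed_word n w) (hw' : timed_word n w') :
  knuth_equivalent n w w' <->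
  (forall u v : tword R, timed_word n u -> timed_word n v ->
   forall k : nat, (1 <= k)%N ->
   greene k (u * w * v)%TW = greene k (u * w' * v)%TW).
Proof.
split=> [h u v hu hv k _|H]; first exact: knuth_greene h.
have [l pl el] := timed_word_blocksP hw.
have [l' pl' el'] := timed_word_blocksP hw'.
rewrite el in hw H *; rewrite el' in hw' H *.
have wl := block_word_positive pl hw; have wl' := block_word_positive pl' hw'.
have [T hT lT] := tableau_exists wl; have [T' hT' lT'] := tableau_exists wl'.
apply: block_equiv_knuth => //.
apply: (block_equiv_trans lT); apply: block_equiv_trans (block_equiv_sym lT').
have nT := block_word_nonneg (block_word_reading n hT).
have nT' := block_word_nonneg (block_word_reading n hT').
(* A single [M] that bounds the weights of both tableaux, since both words are tested in the same
   context. *)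
pose M : R := (weight (reading n T) + weight (reading n T'))%R.
have M0 : (0 <= M)%R by rewrite addr_ge0 ?weight_ge0.
apply: reading_equiv => i m mn; apply: eq_row_sums => // k hk.
have /andP[k0 km] := hk.
have wv : block_word n (staircase m k M) by rewrite block_word_staircase ?km.
have key l0 T0 : block_word n l0 -> tableau T0 -> block_equiv n l0 (reading n T0) ->
    (weight (reading n T0) <= M)%R ->
    greene k (tempty R * blocks l0 * blocks (staircase m k M))%TW =
    (\sum_(j < k) nth (@zero_row R) T0 j m + M * k%:R)%R.
  move=> w0 h0 e0 hM; rewrite -(greene_staircase h0 hk mn hM).
  have n0 := block_word_nonneg w0.
  rewrite tempty_blocks // -blocks_cat ?(block_word_nonneg wv) //.
  apply: (@block_equiv_greene _ n); last by rewrite block_word_cat w0.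
  by apply: block_equiv_cat => //; exact: block_equiv_refl.
have := H (tempty R) _ (timed_word_tempty R n) (timed_word_blocks wv) k k0.
rewrite (key l T) // ?(key l' T') // ?lerDl ?lerDr ?weight_ge0 //.
by move/addIr.
Qed.
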